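(* Let $q\in(0,1)$, $a>0$, $b<0$ with $|b|>|a|$, and put $\kappa=-\log|b/a|/\log(1/q)$. For $\varphi\in C([0,\infty);\mathbb{R})$ let $z$ denote the unique continuous solution of $$z'(t)=az(qt)+bz(t)+\varphi(t),\quad t\ge0;\qquad z(0)=\xi\in\mathbb{R}.$$ (a) For every $C>0$ and every $\gamma\in\mathrm{RV}_\infty(\kappa)$ such that $t\mapsto\gamma(t)/t^{\kappa+1}$ is not in $L^1(0,\infty)$, there exists $\varphi\in C([0,\infty);\mathbb{R})$ with $\varphi(t)\sim C\gamma(t)$ as $t\to\infty$ such that, for some $D>0$, $$z(t)\sim Dt^\kappa\int_1^t\frac{\gamma(s)}{s^{\kappa+1}}\,ds,\quad t\to\infty.$$ (b) For every $C>0$ and every $\gamma\in\mathrm{RV}_\infty(\kappa)$ such that $t\mapsto\gamma(t)/t^{\kappa+1}$ is in $L^1(0,\infty)$, there exists $\varphi\in C([0,\infty);\mathbb{R})$ with $\varphi(t)\sim C\gamma(t)$ as $t\to\infty$ such that $z(t)\sim Dt^\kappa$ as $t\to\infty$ for some $D>0$.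
   Context: $\gamma\in\mathrm{RV}_\infty(\kappa)$ means that $\gamma:[0,\infty)\to(0,\infty)$ is a measurable function that is regularly varying at infinity with index $\kappa$: $\lim_{t\to\infty}\gamma(\lambda t)/\gamma(t)=\lambda^\kappa$ for every $\lambda>0$. The notation $g(t)\sim h(t)$ as $t\to\infty$ means $g(t)/h(t)\to1$ as $t\to\infty$.
   Formalization: In part (a) it is additionally assumed that γ(t)/t^{κ+1} is integrable on [1,T] for every T≥1; otherwise the integral from 1 to t in the conclusion is infinite for all large t and the claim fails. *)

(* Defs.v *)
From HB Require Import structures.
From mathcomp Require Import all_boot all_order all_algebra.
From mathcomp Require Import all_classical all_reals all_analysis.

Set Implicit Arguments.
Unset Strict Implicit.
Unset Printing Implicit Defensive.

Import Order.TTheory GRing.Theory Num.Theory.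
Import numFieldNormedType.Exports.

Local Open Scope classical_set_scope.
Local Open Scope ring_scope.

(* Functions on [0, oo) are represented by total functions R -> R, of which
   only the values on [0, oo) matter. *)

(* R with the sigma-algebra of Lebesgue measurable sets, the domain of
   completed_lebesgue_measure; the canonical structure on R is only Borel. *)
Definition lebesgueTypeR (R : realType) :=
  caratheodory_type (wlength (@idfun R))^*%mu.

Definition lebesgue_measurable_fun (R : realType) (D : set R) (f : R -> R) : Prop :=
  measurable_fun (D : set (lebesgueTypeR R)) (f : lebesgueTypeR R -> R).

Definition lebesgue_L1 (R : realType) (D : set R) (f : R -> R) : Prop :=
  (@completed_lebesgue_measure R).-integrable D (fun t => (f t)%:E).

Definition lebesgue_int (R : realType) (x y : R) (f : R -> R) : R :=
  (\int[@completed_lebesgue_measure R]_(s in `[x, y]) f s)%R.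

Definition regularly_varying (R : realType) (kappa : R) (gamma : R -> R) : Prop :=
  [/\ forall t : R, 0 <= t -> 0 < gamma t,
      lebesgue_measurable_fun `[0, +oo[ gamma &
      forall lambda : R, 0 < lambda ->
        gamma (lambda * t) / gamma t @[t --> +oo] --> lambda `^ kappa].

Definition asymp_equiv (R : realType) (g h : R -> R) : Prop :=
  g t / h t @[t --> +oo] --> (1 : R).

(* l is the derivative of z at t relative to [0, oo): two-sided if t > 0,
   one-sided if t = 0. *)
Definition halfline_derivative (R : realType) (z : R -> R) (t l : R) : Prop :=
  (z s - z t) / (s - t) @[s --> within `[0, +oo[%classic t^'] --> l.

Definition pantograph_solution (R : realType) (q a b : R) (phi : R -> R)
    (xi : R) (z : R -> R) : Prop :=
  [/\ {within `[0, +oo[%classic, continuous z},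
      forall t : R, 0 <= t ->
        halfline_derivative z t (a * z (q * t) + b * z t + phi t) &
      z 0 = xi].

Definition unique_pantograph_solution (R : realType) (q a b : R)
    (phi : R -> R) (xi : R) (z : R -> R) : Prop :=
  pantograph_solution q a b phi xi z /\
  forall w : R -> R, pantograph_solution q a b phi xi w ->
    forall t : R, 0 <= t -> w t = z t.

(* Main.v *)
Require Import Defs.
From HB Require Import structures.
From mathcomp Require Import all_boot all_order all_algebra.
From mathcomp Require Import all_classical all_reals all_analysis.
From mathcomp Require Import measurable_realfun ring lra.

Set Implicit Arguments.
Unset Strict Implicit.
Unset Printing Implicit Defensive.

Import Order.TTheory GRing.Theory Num.Theory.
Import numFieldNormedType.Exports.

Local Open Scope classical_set_scope.
Local Open Scope ring_scope.

(** The equation is solved backwards: the solution is chosen first and the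
    forcing term is read off from it. The exponent satisfies
    [a * q `^ kappa = - b] ([pantograph_exponent]), so that t^kappa annihilates
    the functional part a z(qt) + b z(t). For z(t) = (1 + t)^kappa u(t) the
    forcing term phi(t) = z'(t) - a z(qt) - b z(t) is therefore
    - b t^kappa (u(t) - u(qt)), up to terms of the size of t^(kappa-1) u(t) and
    t^kappa u'(t) ([pantograph_residual_asymptotics]).

    Put ell(t) = gamma(t) / t^kappa, a slowly varying function, and
    J(t) = int_1^t ell(s)/s ds, which is the integral of the statement. Slow
    variation gives J(t) - J(qt) ~ ln(1/q) ell(t), and also J(t) = o(t ell(t)).
    So any u that stays close to D J and has a small derivative produces
    phi ~ - b D ln(1/q) gamma, and D = C / (- b ln(1/q)) is the right constant.
    The growth of z is that of t^kappa u(t): when J is unbounded, u ~ D J; when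
    J is bounded, u converges, and z is asymptotic to a multiple of t^kappa. When
    gamma(t)/t^(kappa+1) fails to be integrable near 0 alone, J is still
    bounded; z is then asymptotic to a multiple of t^kappa J(t) as well, because
    J has a positive limit ([pantograph_construction]).

    Two points need work. First, gamma is only measurable, so J need not be
    differentiable and is replaced by its moving average
    I(t) = int_t^(t+1) J, which is C^1 and lies between J(t) and J(t+1)
    ([slow_primitive_smoothing]); the profile is
    u(t) = xi + K t/(1+t) + D I(t), where the bounded term with K = |xi| + 1
    makes the limit of u positive whatever the sign of xi. Secondly, all
    estimates require the limit defining slow variation to be uniform over
    compact sets of dilation factors. This is the uniform convergence theorem
    ([lebesgue_uniform_slow_increments]), proved by the argument of Csiszar and
    Erdos from Egorov's theorem and the scaling of Lebesgue measure.

    Uniqueness is a maximum principle: a + b < 0 forbids a positive maximum of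
    a solution of the homogeneous equation ([homogeneous_pantograph_le0]). *)


(** * Dilations of the Lebesgue sigma-algebra *)

Lemma ocitv_preimage_scale (R : realType) (c : R) (A : set R) : 0 < c ->
  ocitv A -> ocitv ( *%R c @^-1` A) /\
  wlength idfun ( *%R c @^-1` A) = (c^-1%:E * wlength idfun A)%E.
Proof.
move=> c0 /ocitvP[->|[[x y] /= xy ->]].
  by rewrite preimage_set0 wlength0 mule0; split => //; exact: ocitv0.
have -> : *%R c @^-1` `]x, y] = `](c^-1 * x), (c^-1 * y)]%classic.
  apply/seteqP; split => t /=; rewrite !in_itv/=;
  by rewrite ltr_pdivrMl// ler_pdivlMl.
split; first exact: is_ocitv.
rewrite !wlength_itv_bnd ?ltW// ?ltr_pM2l ?invr_gt0//.
by rewrite -EFinM mulrBr.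
Qed.

(** Dilating a cover by half-open intervals dilates the sum of the lengths. The
    reverse inequality is the same statement for [c^-1]. *)
Lemma lebesgue_outer_preimage_scale (R : realType) (c : R) (A : set R) :
  0 < c ->
  ((wlength idfun)^*%mu ( *%R c @^-1` A) <= c^-1%:E * (wlength idfun)^*%mu A)%E.
Proof.
move=> c0; rewrite lee_pdivlMl//.
apply: le_ereal_inf_tmp => _ [B [mB AB] <-].
rewrite -lee_pdivlMl//.
apply: ereal_inf_lbound; exists (fun k => *%R c @^-1` (B k)).
  split => [k|x /= /AB[k _ Bk]]; last by exists k.
  by have [] := ocitv_preimage_scale c0 (mB k).
rewrite -nneseriesZl.
  apply: eq_eseriesr => k _.
  by have [] := ocitv_preimage_scale c0 (mB k).
by move=> k _; exact: (measure_ge0 (wlength idfun)).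
Qed.

(** Caratheodory's criterion is preserved because the dilation by [c] can be
    transferred to the test set, where it costs a factor that the inverse
    dilation gives back. *)
Lemma lebesgue_measurable_scale (R : realType) (c : R) : 0 < c ->
  measurable_fun [set: lebesgueTypeR R]
    (fun x : lebesgueTypeR R => (c * (x : R) : R) : lebesgueTypeR R).
Proof.
move=> c0 _ E mE; rewrite setTI.
apply: le_caratheodory_measurable => X.
have XE (B : set R) : X `&` *%R c @^-1` B =
    *%R c @^-1` ( *%R c^-1 @^-1` X `&` B).
  apply/seteqP; split => x /= [Xx Bx]; split => //.
    by rewrite mulKf// gt_eqF.
  by move: Xx; rewrite mulKf// gt_eqF.
rewrite -[_ @^-1` E]/( *%R c @^-1` E) preimage_setC !XE.
apply: (le_trans (leeD (lebesgue_outer_preimage_scale _ c0)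
  (lebesgue_outer_preimage_scale _ c0))).
rewrite -muleDr ?ge0_adde_def ?inE ?outer_measure_ge0//.
rewrite -mE -[leRHS]mul1e -(mulVf (lt0r_neq0 c0)) EFinM -muleA.
rewrite lee_pmul2l ?lte_fin ?invr_gt0//.
by have := @lebesgue_outer_preimage_scale _ c^-1 X; rewrite invrK invr_gt0; apply.
Qed.

(** * The uniform convergence theorem for slowly varying functions *)

(** [D] has to be Borel: since [measurable_fun D f] is vacuous when [D] is not
    measurable, it would say nothing about [f] on a set [D] that is Lebesgue but
    not Borel measurable. *)
Lemma lebesgue_measurable_fun_borel (R : realType) (D : set R) (f : R -> R) :
  measurable D -> measurable_fun D f -> lebesgue_measurable_fun D f.
Proof.
by move=> mD mf _ E mE; apply: sub_caratheodory; exact: mf.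
Qed.

Lemma lebesgueTypeR_itv (R : realType) (i : interval R) :
  measurable ([set` i] : set (lebesgueTypeR R)).
Proof.
by apply: sub_caratheodory; exact: measurable_itv.
Qed.

Lemma lebesgue_outer_itvoc (R : realType) (x y : R) : x <= y ->
  ((wlength idfun)^*%mu (`]x, y]%classic : set R) = (y - x)%:E)%E.
Proof.
move=> xy; rewrite measurable_mu_extE; last exact: is_ocitv.
exact: (@wlength_itv_bnd R idfun x y false false xy).
Qed.

(** The uniform convergence theorem, for the additive increments of [h] along
    dilations. If uniformity fails, there are x_n -> oo and l_n in [1, L] with
    increments at least [e]. By Egorov, the increments from x_n and those from
    l_n x_n are both smaller than [e / 2] for factors in [1, L + 1] outside sets
    of small measure. After rescaling the second set by l_n, these exceptional
    sets are too small to cover [l_n, L + 1], whose length is at least 1; a point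
    y outside of both gives two small increments, from x_n to y x_n and from
    l_n x_n to y x_n, and hence a small increment from x_n to l_n x_n. *)
Lemma lebesgue_uniform_slow_increments (R : realType) (h : R -> R) (L : R) :
  lebesgue_measurable_fun `[1, +oo[ h ->
  (forall l, 1 <= l -> h (l * t) - h t @[t --> +oo] --> 0) ->
  forall e : R, 0 < e -> \forall t \near +oo,
    forall l, 1 <= l <= L -> `|h (l * t) - h t| < e.
Proof.
move=> mh hl e e0.
have [L1|L1] := ltP L 1.
  near=> t => l /andP[l1 lL]; exfalso.
  by move: (lt_le_trans L1 l1); rewrite ltNge lL.
apply: contrapT => nP.
have cex (n : nat) : exists xl : R * R, [/\ n.+1%:R <= xl.1, 1 <= xl.2 <= L &
    e <= `|h (xl.2 * xl.1) - h xl.1|].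
  apply: contrapT => nE; apply: nP.
  have := @nbhs_pinfty_ge R n.+1%:R (num_real _).
  apply: filterS => t nt l lL.
  by rewrite ltNge; apply/negP => eh; apply: nE; exists (t, l); split.
pose x n := (projT1 (cid (cex n))).1; pose l n := (projT1 (cid (cex n))).2.
have xP n : n.+1%:R <= x n by rewrite /x; case: cid => ? [].
have lP n : 1 <= l n <= L by rewrite /l; case: cid => ? [].
have hP n : e <= `|h (l n * x n) - h (x n)| by rewrite /l /x; case: cid => ? [].
have x1 n : 1 <= x n by apply: le_trans (xP n); rewrite ler1n.
have l1 n : 1 <= l n by have /andP[] := lP n.
pose A : set (lebesgueTypeR R) := `[1, (L + 1)]%classic.
have mA : measurable A by exact: lebesgueTypeR_itv.
have Afin : (@completed_lebesgue_measure R A < +oo)%E.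
  apply: (@le_lt_trans _ _ ((wlength idfun)^*%mu (`]0, (L + 1)]%classic : set R))).
    apply: le_outer_measure => s; rewrite /A/= !in_itv/= => /andP[s1 ->].
    by rewrite (lt_le_trans _ s1).
  by rewrite lebesgue_outer_itvoc ?ltry// addr_ge0// (le_trans _ L1).
have ego (y : nat -> R) : (forall n, n.+1%:R <= y n) ->
  exists B : set (lebesgueTypeR R), [/\ measurable B,
    (@completed_lebesgue_measure R B < ((2 * (1 + L))^-1)%:E)%E &
    \forall n \near \oo, forall s, (A `\` B) s -> `|h (s * y n) - h (y n)| < e / 2].
  move=> yP.
  have y1 n : 1 <= y n by apply: le_trans (yP n); rewrite ler1n.
  have ycvg : y @ \oo --> +oo.
    apply/cvgryPge => M; near=> n; apply: le_trans (yP n).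
    near: n; exists (Num.truncn `|M|) => // n /= Mn.
    apply: (le_trans (ler_norm _)); apply/ltW/(lt_le_trans (truncnS_gt _)).
    by rewrite ler_nat.
  have [] := @pointwise_almost_uniform _ R _ (@completed_lebesgue_measure R)
    (fun n s => h (s * y n) - h (y n)) (cst 0) A ((2 * (1 + L))^-1) _ mA Afin.
  - move=> n; apply: measurable_funB; last exact: measurable_cst.
    under eq_fun do rewrite mulrC.
    apply: (@measurable_comp _ _ _ _ _ _
      (`[1, +oo[%classic : set (lebesgueTypeR R)) (h : lebesgueTypeR R -> R) A
      (fun s : lebesgueTypeR R => (y n * (s : R) : R) : lebesgueTypeR R)).
    + exact: lebesgueTypeR_itv.
    + move=> _ [s As <-]; move: As; rewrite /A/= !in_itv/= andbT => /andP[s1 _].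
      by rewrite -(mulr1 1) ler_pM.
    + exact: mh.
    + apply: measurable_funTS; apply: lebesgue_measurable_scale.
      by rewrite (lt_le_trans _ (y1 n)).
  - move=> s; rewrite /A/= in_itv/= => /andP[s1 _].
    exact: (cvg_comp _ _ ycvg (hl s s1)).
  - by rewrite invr_gt0 mulr_gt0// addr_gt0// (lt_le_trans _ L1).
  move=> B [mB Bsm Bu]; exists B; split => //.
  apply: (Bu [set g | forall s, (A `\` B) s -> `|g s| < e / 2]).
  apply/uniform_nbhs; exists [set st | ball st.1 (e / 2) st.2]; split.
    by rewrite -entourage_ballE; exists (e / 2) => //=; rewrite divr_gt0.
  by move=> g Eg s /Eg; rewrite /= /ball/= sub0r normrN.
have [B [mB Bsm Bu]] := ego x xP.
have [|B' [mB' Bsm' Bu']] := ego (fun n => l n * x n).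
  move=> n; apply: le_trans (xP n) _; rewrite ler_peMl//.
  by rewrite (le_trans _ (x1 n)).
have [n [BX BX']] : exists n,
  (forall s, (A `\` B) s -> `|h (s * x n) - h (x n)| < e / 2) /\
  (forall s, (A `\` B') s ->
    `|h (s * (l n * x n)) - h (l n * x n)| < e / 2).
  near \oo => n; exists n; split; by near: n.
have ln0 : 0 < l n by rewrite (lt_le_trans _ (l1 n)).
(* otherwise ]l_n, L + 1] is covered by sets of total measure below 1/2 *)
have [y [yA yB yB']] : exists y : R,
    [/\ l n <= y <= L + 1, ~ B y & ~ B' ((l n)^-1 * y)].
  apply: contrapT => nE.
  have sub : (`](l n), (L + 1)]%classic : set R) `<=` B `|` *%R (l n)^-1 @^-1` B'.
    move=> y /=; rewrite in_itv/= => /andP[/ltW ly yL].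
    apply: contrapT => /not_orP[yB yB']; apply: nE; exists y.
    by split => //; rewrite ly.
  have : ((L + 1 - l n)%:E <= (wlength idfun)^*%mu B +
      (wlength idfun)^*%mu ( *%R (l n)^-1 @^-1` B'))%E.
    rewrite -lebesgue_outer_itvoc; last first.
      by have /andP[_ /le_trans] := lP n; apply; rewrite lerDl.
    by apply: le_trans (outer_measureU2 _ _ _); exact: le_outer_measure.
  apply/negP; rewrite -ltNge.
  have Bs : ((wlength idfun)^*%mu ( *%R (l n)^-1 @^-1` B') <
     (L * (2 * (1 + L))^-1)%:E)%E.
    have := @lebesgue_outer_preimage_scale _ (l n)^-1 B'.
    rewrite invrK invr_gt0 => /(_ ln0)/le_lt_trans; apply.
    rewrite -lte_pdivlMl//; apply: (lt_le_trans Bsm').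
    rewrite -EFinM lee_fin mulrA ler_peMl//.
      by rewrite invr_ge0 mulr_ge0// addr_ge0// (le_trans _ L1).
    by rewrite ler_pdivlMl// mulr1; have /andP[] := lP n.
  apply: (lt_le_trans (lteD Bsm Bs)).
  have L10 : 1 + L != 0 by rewrite gt_eqF// addr_gt0// (lt_le_trans _ L1).
  rewrite -EFinD lee_fin.
  have -> : ((2 * (1 + L))^-1 + L * (2 * (1 + L))^-1) = 2^-1 by field.
  have /andP[_ lL] := lP n.
  lra.
have : `|h (l n * x n) - h (x n)| < e.
  have /andP[ly yL] := yA.
  have e1 : `|h (y * x n) - h (x n)| < e / 2.
    by apply: BX; split => //; rewrite /A/= in_itv/= yL (le_trans (l1 n)).
  have e2 : `|h (y * x n) - h (l n * x n)| < e / 2.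
    have -> : y * x n = (l n)^-1 * y * (l n * x n).
      by field; rewrite gt_eqF.
    apply: BX'; split => //; rewrite /A/= in_itv/= ler_pdivlMl// mulr1 ly/=.
    rewrite ler_pdivrMl// (le_trans yL)// ler_peMl// addr_ge0//.
    by rewrite (le_trans _ L1).
  move: e1 e2; rewrite !ltr_norml => /andP[? ?] /andP[? ?]; apply/andP; split; lra.
by rewrite ltNge hP.
Unshelve. all: by end_near.
Qed.

(** * Logarithmic bounds for Lebesgue integrals *)

(** The Borel measure is the image of its completion under the identity, so
    this is a change of variables. *)
Lemma ge0_completed_integralE (R : realType) (D : set R) (f : R -> \bar R) :
  measurable D -> measurable_fun D f -> {in D, forall x, (0 <= f x)%E} ->
  (\int[@completed_lebesgue_measure R]_(x in (D : set (lebesgueTypeR R))) f x =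
   \int[@lebesgue_measure R]_(x in D) f x)%E.
Proof.
move=> mD mf f0.
pose phi (x : lebesgueTypeR R) : measurableTypeR R := x.
have mphi : measurable_fun setT phi.
  by move=> _ E mE; rewrite setTI; apply: sub_caratheodory.
rewrite -(@ge0_integral_pushforward _ _ _ _ R phi mphi
  (@completed_lebesgue_measure R) D f mD mf f0).
exact: eq_measure_integral.
Qed.

Lemma completed_integral_inv (R : realType) (x y : R) : 0 < x -> x < y ->
  (\int[@completed_lebesgue_measure R]_(s in `]x, y]) (s^-1)%:E =
  (ln y - ln x)%:E)%E.
Proof.
move=> x0 xy.
have cinv : {within `[x, y], continuous (@GRing.inv R)}.
  apply: continuous_in_subspaceT => s; rewrite inE/= in_itv/= => /andP[xs _].
  by apply: inv_continuous; rewrite gt_eqF// (lt_le_trans x0).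
have minv : measurable_fun `[x, y] (@GRing.inv R).
  by apply: subspace_continuous_measurable_fun.
rewrite ge0_completed_integralE//.
- rewrite integral_itv_obnd_cbnd; last first.
    apply/measurable_EFinP; apply: measurable_funS minv => //.
    exact: subset_itv_oc_cc.
  rewrite (continuous_FTC2 xy cinv (F := @ln R))//.
  + split.
    * move=> s; rewrite in_itv/= => /andP[xs _].
      by apply: ex_derive; apply: is_derive1_ln; rewrite (lt_trans x0).
    * by apply: cvg_at_right_filter; exact: continuous_ln.
    * by apply: cvg_at_left_filter; apply: continuous_ln; exact: lt_trans xy.
  + move=> s; rewrite in_itv/= => /andP[xs _].
    by rewrite derive1E; apply: derive_val; apply: is_derive1_ln; rewrite (lt_trans x0).
- apply/measurable_EFinP; apply: measurable_funS minv => //.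
  exact: subset_itv_oc_cc.
- move=> s; rewrite inE/= in_itv/= => /andP[xs _].
  by rewrite lee_fin invr_ge0 ltW// (lt_trans x0).
Qed.

Lemma completed_integrable_inv (R : realType) (x y : R) : 0 < x -> x < y ->
  lebesgue_L1 `]x, y] (fun s => s^-1).
Proof.
move=> x0 xy; apply/integrableP; split.
  apply/measurable_EFinP; apply: lebesgue_measurable_fun_borel => //.
  apply: subspace_continuous_measurable_fun => //.
  apply: continuous_in_subspaceT => s; rewrite inE/= in_itv/= => /andP[xs _].
  by apply: inv_continuous; rewrite gt_eqF// (lt_trans x0).
rewrite (eq_integral (fun s : lebesgueTypeR R => ((s : R)^-1)%:E))
  ?completed_integral_inv ?ltry//.
move=> s; rewrite inE/= in_itv/= => /andP[xs _].
by rewrite ger0_norm// invr_ge0 ltW// (lt_trans x0).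
Qed.

Lemma lebesgue_int_increment (R : realType) (w : R -> R) (x y : R) :
  lebesgue_L1 `[1, y] w -> 1 <= x -> x <= y ->
  lebesgue_int 1 y w - lebesgue_int 1 x w =
  (\int[@completed_lebesgue_measure R]_(s in `]x, y]) w s)%R.
Proof.
move=> wL x1 xy; rewrite /lebesgue_int.
have yE : `[1, y]%classic = `[1, x]%classic `|` `]x, y]%classic.
  by rewrite -itv_bndbnd_setU.
rewrite yE Rintegral_setU//.
- by rewrite addrC addKr.
- exact: lebesgueTypeR_itv.
- exact: lebesgueTypeR_itv.
- by rewrite -yE.
- apply/disj_setPS => s /= []; rewrite !in_itv/= => /andP[_ sx] /andP[xs _].
  by move: (lt_le_trans xs sx); rewrite ltxx.
Qed.

(** [s * w s] is the natural quantity to bound, because in the sequel it is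
    slowly varying and thus nearly constant on [x, y] while [w] is not. *)
Lemma lebesgue_int_log_bounds (R : realType) (w : R -> R) (x y c : R) :
  lebesgue_L1 `[1, y] w -> 1 <= x -> x <= y ->
  ((forall s, x <= s <= y -> c <= s * w s) ->
    c * (ln y - ln x) <= lebesgue_int 1 y w - lebesgue_int 1 x w) /\
  ((forall s, x <= s <= y -> s * w s <= c) ->
    lebesgue_int 1 y w - lebesgue_int 1 x w <= c * (ln y - ln x)).
Proof.
move=> wL x1; rewrite le_eqVlt => /predU1P[<-|xy].
  by rewrite !subrr !mulr0 lexx.
have x0 : 0 < x by rewrite (lt_le_trans _ x1).
rewrite (lebesgue_int_increment wL x1 (ltW xy)).
have iv := completed_integrable_inv x0 xy.
have mI : measurable (`]x, y]%classic : set (lebesgueTypeR R)).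
  exact: lebesgueTypeR_itv.
have <- : (\int[@completed_lebesgue_measure R]_(s in `]x, y]) (c * s^-1))%R =
    c * (ln y - ln x).
  by rewrite RintegralZl// /Rintegral completed_integral_inv.
have iw : (@completed_lebesgue_measure R).-integrable `]x, y] (EFin \o w).
  apply: integrableS wL => //; first exact: lebesgueTypeR_itv.
  by move=> s /=; rewrite !in_itv/= => /andP[/ltW xs ->]; rewrite (le_trans x1).
have ic : (@completed_lebesgue_measure R).-integrable `]x, y]
    (EFin \o (fun s => c * s^-1)).
  by have := integrableZl mI c iv; apply: eq_integrable.
split => cw; apply: le_Rintegral => // s; rewrite /= in_itv/= => /andP[xs sy];
  have s0 : 0 < s by apply: lt_trans xs.
- by rewrite ler_pdivrMr// mulrC cw// ltW.
- by rewrite ler_pdivlMr// mulrC cw// ltW.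
Qed.

(** * Primitives of slowly varying functions *)

(** What the sequel uses of a slowly varying [ell] and of its primitive
    [J t] = int_1^t ell(s)/s ds: uniform slow variation, and the comparison of
    the increments of [J] with those of the logarithm. Stated in this way, no
    integral appears in the asymptotic analysis. *)
Definition slow_primitive (R : realType) (ell J : R -> R) : Prop :=
  [/\ forall t, 1 <= t -> 0 < ell t,
      forall L e : R, 0 < e -> \forall t \near +oo,
        forall s, t <= s <= L * t -> (1 - e) * ell t <= ell s <= (1 + e) * ell t,
      0 <= J 1,
      forall c x y, 1 <= x -> x <= y ->
        (forall s, x <= s <= y -> c <= ell s) -> c * (ln y - ln x) <= J y - J x &
      forall c x y, 1 <= x -> x <= y ->
        (forall s, x <= s <= y -> ell s <= c) -> J y - J x <= c * (ln y - ln x)].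

Lemma near_pinftyP (R : realType) (P : R -> Prop) :
  (\forall t \near +oo, P t) -> exists2 X, 1 <= X & forall t, X <= t -> P t.
Proof.
move=> [X [_ XP]]; exists (Num.max 1 (X + 1)); first by rewrite le_max lexx.
by move=> t; rewrite ge_max => /andP[_ Xt]; apply: XP; rewrite (lt_le_trans _ Xt)// ltrDl.
Qed.

Lemma cvg_pinfty_le (R : realType) (f : R -> R) (l : R) :
  (forall e : R, 0 < e -> \forall t \near +oo, `|f t - l| <= e) ->
  f t @[t --> +oo] --> l.
Proof.
move=> fl; apply/cvgrPdist_le => e e0; near=> t.
by rewrite distrC; near: t; exact: fl.
Unshelve. all: by end_near. Qed.

Lemma cvg_pinfty_eq (R : realType) (f g : R -> R) (l : R) :
  (\forall t \near +oo, f t = g t) -> f t @[t --> +oo] --> l ->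
  g t @[t --> +oo] --> l.
Proof. by move=> fg; apply: cvg_trans; exact: near_eq_cvg. Qed.

Lemma ln_increment_le (R : realType) (x y : R) : 0 < x -> x <= y ->
  ln y - ln x <= (y - x) / x.
Proof.
move=> x0 xy; have y0 := lt_le_trans x0 xy.
rewrite -ln_div ?posrE//.
have -> : (y - x) / x = y / x - 1 by rewrite mulrBl divff// gt_eqF.
have := @le_ln1Dx R (y / x - 1).
by rewrite addrCA subrr addr0; apply; rewrite ltrBDl subrr divr_gt0.
Qed.

Lemma ratio_dist_le (R : realType) (u v l e : R) : 0 < v ->
  (l - e) * v <= u <= (l + e) * v -> `|u / v - l| <= e.
Proof.
move=> v0 /andP[lu ul]; rewrite ler_norml lerBlDl lerBrDl.
by rewrite ler_pdivlMr// ler_pdivrMr// lu ul.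
Qed.

Lemma slow_primitive_mono (R : realType) (ell J : R -> R) :
  slow_primitive ell J -> forall x y, 1 <= x -> x <= y -> J x <= J y.
Proof.
move=> [ell0 _ _ Jlb _] x y x1 xy; rewrite -subr_ge0.
rewrite -[leLHS](mul0r (ln y - ln x)); apply: Jlb => // s /andP[xs _].
by rewrite ltW// ell0// (le_trans x1).
Qed.

Lemma slow_ratio (R : realType) (ell J : R -> R) (q : R) :
  slow_primitive ell J -> 0 < q -> q < 1 ->
  ell (q * t) / ell t @[t --> +oo] --> (1 : R).
Proof.
move=> [ell0 ellU _ _ _] q0 q1.
rewrite -[X in _ --> X]invr1.
under eq_fun do rewrite -invf_div.
apply: cvgV; first exact: oner_neq0.
apply: cvg_pinfty_le => e e0.
have [X X1 XP] := near_pinftyP (ellU q^-1 e e0).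
near=> t.
have qt : X <= q * t.
  by rewrite -ler_pdivrMl// mulrC; near: t; apply: nbhs_pinfty_ge; exact: num_real.
have qt0 : 0 < ell (q * t) by apply: ell0; exact: le_trans qt.
apply: ratio_dist_le => //; apply: XP => //.
have t0 : 0 < t by near: t; apply: nbhs_pinfty_gt; exact: num_real.
by rewrite mulKf ?gt_eqF// lexx andbT ger_pMl ?ltW.
Unshelve. all: by end_near. Qed.

(** On [q t, t] the function [ell] is nearly constant, and the logarithm grows
    by [ln q^-1] there. *)
Lemma slow_primitive_increment (R : realType) (ell J : R -> R) (q : R) :
  slow_primitive ell J -> 0 < q -> q < 1 ->
  (J t - J (q * t)) / ell t @[t --> +oo] --> ln q^-1.
Proof.
move=> S q0 q1; have [ell0 ellU _ Jlb Jub] := S.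
have lq0 : 0 < ln q^-1 by rewrite ln_gt0// invf_gt1.
have H : (J t - J (q * t)) / ell (q * t) @[t --> +oo] --> ln q^-1.
  apply: cvg_pinfty_le => e e0.
  have [X X1 XP] := near_pinftyP (ellU q^-1 (e / ln q^-1) (divr_gt0 e0 lq0)).
  near=> t.
  have t0 : 0 < t by near: t; apply: nbhs_pinfty_gt; exact: num_real.
  have qt : X <= q * t.
    by rewrite -ler_pdivrMl// mulrC; near: t; apply: nbhs_pinfty_ge; exact: num_real.
  have qt1 : 1 <= q * t by exact: le_trans qt.
  have qt0 : 0 < ell (q * t) by exact: ell0.
  have qtt : q * t <= t by rewrite ger_pMl ?ltW.
  have lnE : ln t - ln (q * t) = ln q^-1.
    by rewrite lnM ?posrE// lnV ?posrE//; ring.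
  have tE : q^-1 * (q * t) = t by rewrite mulKf ?gt_eqF.
  apply: ratio_dist_le => //; apply/andP; split.
  - have -> : (ln q^-1 - e) * ell (q * t) =
        ((1 - e / ln q^-1) * ell (q * t)) * (ln t - ln (q * t)).
      by rewrite lnE; field; rewrite gt_eqF.
    by apply: Jlb => // s sP; have /andP[] := XP _ qt s ltac:(by rewrite tE).
  - have -> : (ln q^-1 + e) * ell (q * t) =
        ((1 + e / ln q^-1) * ell (q * t)) * (ln t - ln (q * t)).
      by rewrite lnE; field; rewrite gt_eqF.
    by apply: Jub => // s sP; have /andP[] := XP _ qt s ltac:(by rewrite tE).
apply: (@cvg_pinfty_eq _ (fun t =>
  (J t - J (q * t)) / ell (q * t) * (ell (q * t) / ell t))); last first.
  by rewrite -[X in _ --> X]mulr1; apply: cvgM => //; exact: (slow_ratio S).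
near=> t.
have t0 : 0 < ell (q * t).
  have qt : q^-1 <= t by near: t; apply: nbhs_pinfty_ge; exact: num_real.
  by apply: ell0; rewrite -ler_pdivrMl// mulr1.
by rewrite /= mulrA divfK// gt_eqF.
Unshelve. all: by end_near. Qed.

Lemma slow_primitive_unit_step (R : realType) (ell J : R -> R) :
  slow_primitive ell J ->
  \forall t \near +oo, J (t + 1) - J t <= 2 * ell t / t.
Proof.
move=> S; have [ell0 ellU _ _ Jub] := S.
have H := ellU 2 1 ltr01; near=> t.
have t1 : 1 <= t by near: t; apply: nbhs_pinfty_ge; exact: num_real.
have tP : forall s, t <= s <= 2 * t ->
  (1 - 1) * ell t <= ell s <= (1 + 1) * ell t by near: t.
have t0 : 0 < t by rewrite (lt_le_trans _ t1).
apply: (@le_trans _ _ (2 * ell t * (ln (t + 1) - ln t))).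
  apply: Jub => //; first by rewrite lerDl.
  move=> s /andP[ts st]; have [|_ +] := andP (tP s _); last by lra.
  by rewrite ts/=; lra.
apply: ler_wpM2l; first by rewrite mulr_ge0// ltW// ell0.
have := @ln_increment_le R t (t + 1) t0.
by rewrite lerDl ler01 => /(_ isT); rewrite addrAC subrr add0r div1r.
Unshelve. all: by end_near. Qed.

(** Iterating the contraction from the fundamental domain [X, 2 X] reaches all
    of [X, oo). *)
Lemma contraction_cvg0 (R : realType) (r : R -> R) (X M rho : R) :
  0 < X -> 0 <= rho < 1 -> (forall t, X <= t -> 0 <= r t) ->
  (forall t, X <= t -> r (2 * t) <= rho * r t) ->
  (forall t, X <= t <= 2 * X -> r t <= M) ->
  r t @[t --> +oo] --> 0.
Proof.
move=> X0 /andP[rho0 rho1] r0 rc rM.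
have M0 : 0 <= M.
  by apply: le_trans (rM X _); rewrite ?r0// lexx; lra.
have X0' := ltW X0; have rho1' := ltW rho1.
have half (t : R) : 2 * (t / 2) = t by rewrite mulrC divfK.
have bd n (t : R) : X <= t <= 2 ^+ n.+1 * X -> r t <= M.
  elim: n t => [|n IH] t /andP[Xt tX].
    by apply: rM; rewrite Xt -(expr1 2).
  have [tX'|tX'] := leP t (2 ^+ n.+1 * X); first by apply: IH; rewrite Xt.
  have Xt2 : X <= t / 2.
    rewrite ler_pdivlMr// mulrC (le_trans _ (ltW tX'))// ler_wpM2r//.
    by rewrite exprS ler_peMr// exprn_ege1// ler1n.
  rewrite -(half t) (le_trans (rc _ Xt2))//.
  apply: (@le_trans _ _ (r (t / 2))); first by rewrite ler_piMl ?r0.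
  by apply: IH; rewrite Xt2 ler_pdivrMr// mulrAC -exprSr.
have all n (t : R) : 2 ^+ n * X <= t -> r t <= M * rho ^+ n.
  elim: n t => [|n IH] t Xt.
    rewrite expr0 mulr1; rewrite expr0 mul1r in Xt.
    apply: (bd (Num.truncn (t / X))); rewrite Xt -ler_pdivrMr//=.
    apply: le_trans (ltW (truncnS_gt _)) _.
    by rewrite -natrX ler_nat ltnW// ltn_expl.
  have Xt2 : 2 ^+ n * X <= t / 2 by rewrite ler_pdivlMr// mulrAC -exprSr.
  have Xt3 : X <= t / 2.
    by apply: le_trans Xt2; rewrite ler_peMl// exprn_ege1// ler1n.
  by rewrite -(half t) (le_trans (rc _ Xt3))// exprS mulrCA ler_wpM2l// IH.
apply: cvg_pinfty_le => e e0.
have : M * rho ^+ n @[n --> \oo] --> M * 0.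
  by apply: cvgMr; apply: cvg_expr; rewrite ger0_norm.
rewrite mulr0 => /cvgrPdist_le/(_ e e0)[N _ /(_ N (leqnn _))/= Ne].
near=> t.
have Nt : 2 ^+ N * X <= t by near: t; apply: nbhs_pinfty_ge; exact: num_real.
have Xt : X <= t.
  by apply: le_trans Nt; rewrite ler_peMl// exprn_ege1// ler1n.
rewrite subr0 ger0_norm ?r0// (le_trans (all _ _ Nt))//.
by move: Ne; rewrite sub0r normrN; apply: le_trans; exact: ler_norm.
Unshelve. all: by end_near. Qed.

(** Doubling [t] nearly doubles [t * ell t], whereas [J] increases by
    O(ell t) only. The quotient thus contracts by any factor above 1/2, up to an
    error O(1/t). *)
Lemma slow_primitive_sublinear (R : realType) (ell J : R -> R) :
  slow_primitive ell J -> (1 + J t) / (t * ell t) @[t --> +oo] --> 0.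
Proof.
move=> S; have [ell0 ellU J1 _ Jub] := S.
have e4 : 0 < 4^-1 :> R by [].
have [X X1 XP] := near_pinftyP (ellU 2 _ e4).
have X0 : 0 < X by rewrite (lt_le_trans _ X1).
have J0 (t : R) : 1 <= t -> 0 <= J t.
  by move=> t1; apply: le_trans J1 _; apply: (slow_primitive_mono S).
(* the term 8/t absorbs the error O(1/t) of the doubling step, which makes it
   an exact contraction by 2/3 *)
have H : (1 + J t) / (t * ell t) + 8 / t @[t --> +oo] --> 0.
  apply: (@contraction_cvg0 _ _ X
    ((1 + J (2 * X)) / (X * ((1 - 4^-1) * ell X)) + 8 / X) (2 / 3)) => //.
  - by apply/andP; split; lra.
  - move=> t Xt; have t1 := le_trans X1 Xt; have t0 := lt_le_trans X0 Xt.
    have t0' := ltW t0; have l0 := ltW (ell0 t t1).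
    by rewrite addr_ge0// divr_ge0// ?mulr_ge0// addr_ge0// J0.
  - move=> t Xt; have t1 := le_trans X1 Xt; have t0 := lt_le_trans X0 Xt.
    have l0 := ell0 _ t1.
    have tt : t <= 2 * t by lra.
    have [|l2 _] := andP (XP _ Xt (2 * t) _); first by rewrite tt lexx.
    have JJ : J (2 * t) <= J t + 2 * ell t.
      rewrite -lerBlDl; apply: (@le_trans _ _ ((1 + 4^-1) * ell t * (ln (2 * t) - ln t))).
        by apply: Jub => // s /(XP _ Xt)/andP[].
      rewrite lnM ?posrE// addrK.
      have : ln 2 <= 1 :> R by have := @le_ln1Dx R 1 ltac:(lra); lra.
      by move=> ln2; nra.
    have -> : 2 / 3 * ((1 + J t) / (t * ell t) + 8 / t) =
        (1 + (J t + 2 * ell t)) / (3 / 2 * (t * ell t)) + 8 / (2 * t).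
      by field; rewrite !gt_eqF.
    rewrite lerD2r; apply: ler_pM.
    - by rewrite addr_ge0// J0// (le_trans t1).
    - by rewrite invr_ge0 !mulr_ge0// ltW// ell0// (le_trans t1).
    - by rewrite lerD2l.
    - have tl0 : 0 < t * ell t by exact: mulr_gt0.
      rewrite lef_pV2 ?posrE ?mulr_gt0 ?ell0//; last exact: le_trans tt.
      have := ler_wpM2l (ltW t0) l2; lra.
  - move=> t /andP[Xt tX].
    have t1 := le_trans X1 Xt; have t0 := lt_le_trans X0 Xt.
    have [|lX _] := andP (XP _ (lexx X) t _); first by rewrite Xt.
    have lX0 := ell0 _ X1.
    apply: lerD.
      apply: ler_pM => //.
      + by rewrite addr_ge0// J0.
      + by rewrite invr_ge0 mulr_ge0 ?ltW// ell0.
      + by rewrite lerD2l; apply: (slow_primitive_mono S).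
      + rewrite lef_pV2 ?posrE ?mulr_gt0 ?ell0//; last by lra.
        by apply: ler_pM => //; [exact: ltW|rewrite mulr_ge0 ?ltW//; lra].
    by rewrite ler_wpM2l// lef_pV2.
apply: (@squeeze_cvgr _ _ _ _ (cst 0) (fun t => (1 + J t) / (t * ell t) + 8 / t)) => //.
  near=> t.
  have t1 : 1 <= t by near: t; apply: nbhs_pinfty_ge; exact: num_real.
  have t0 : 0 < t by rewrite (lt_le_trans _ t1).
  have t0' := ltW t0; have l0 := ltW (ell0 t t1).
  by rewrite divr_ge0 ?mulr_ge0 ?addr_ge0 ?J0//= lerDl divr_ge0.
exact: cvg_cst.
Unshelve. all: by end_near.
Qed.

(** * Smoothing the primitive *)

Lemma is_derive_cvg (R : realType) (f : R -> R) (t d : R) :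
  is_derive t 1 f d -> f x @[x --> t] --> f t.
Proof.
move=> fd; have : {for t, continuous f}; last by [].
by apply: differentiable_continuous; apply/derivable1_diffP; exact: ex_derive.
Qed.

Lemma continuous_primitive (R : realType) (g : R -> R) (a : R) :
  continuous g ->
  exists F : R -> R, forall t, a < t -> is_derive t 1 F (g t).
Proof.
move=> cg; exists (fun t => \int[@lebesgue_measure R]_(s in `[a, t]) g s)%R => t at_.
have [] := @continuous_FTC1_closed R g a t (t + 1) _ _ at_ (cg t).
- by rewrite ltrDl.
- apply: continuous_compact_integrable; first exact: segment_compact.
  exact: continuous_subspaceT.
- by move=> d1 d2; apply: DeriveDef; [exact: d1|rewrite -derive1E].
Qed.

Lemma is_derive_affine (R : realType) (F : R -> R) (k c t d : R) :
  is_derive (k * t + c) 1 F d -> is_derive t 1 (fun t => F (k * t + c)) (d * k).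
Proof.
move=> Fd; apply: (@is_derive1_comp _ F (fun t => k * t + c)).
have H : is_derive t 1 (k \*: (@id R) + cst c) (k *: 1 + 0).
  by apply: is_deriveD.
by rewrite addr0 [k *: 1]mulr1 in H.
Qed.

(** The average of [J] over [t, t + 1], where [J] is first frozen on
    (-oo, X] and normalized to vanish there. Freezing is needed because [ell]
    is known to be locally bounded only from some [X] on, so that the
    continuity of [J] is only clear there; the normalization makes [I]
    vanish at 0. *)
Lemma slow_primitive_smoothing (R : realType) (ell J : R -> R) :
  slow_primitive ell J ->
  exists (I I' : R -> R) (c : R), [/\ continuous I',
    forall t : R, 0 <= t -> is_derive t 1 I (I' t),
    I 0 = 0 /\ (forall t : R, 0 <= t -> 0 <= I t),
    \forall t \near +oo, `|I t - (J t - c)| <= 2 * ell t / t &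
    \forall t \near +oo, `|I' t| <= 2 * ell t / t].
Proof.
move=> S; have [ell0 ellU _ _ Jub] := S.
have [X X1 XP] := near_pinftyP (ellU 2 1 ltr01).
have X0 : 0 < X by rewrite (lt_le_trans _ X1).
have X0' := ltW X0.
(* each doubling of the range costs at most a factor 2 *)
have bd n (t : R) : X <= t <= 2 ^+ n * X -> ell t <= 2 ^+ n * ell X.
  elim: n t => [|n IH] t.
    by rewrite expr0 !mul1r -eq_le => /eqP ->.
  move=> /andP[Xt tX].
  have [tX'|tX'] := leP t (2 ^+ n * X).
    apply: le_trans (IH _ _) _; first by rewrite Xt.
    by rewrite ler_wpM2r ?ler_weXn2l ?ler1n// ltW// ell0.
  have [t2X|t2X] := leP X (t / 2); last first.
    have [|_ tl] := andP (XP _ (lexx X) t _).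
      by rewrite Xt/=; lra.
    apply: le_trans tl _; apply: ler_wpM2r; first by rewrite ltW// ell0.
    by rewrite exprS ler_peMr// exprn_ege1// ler1n.
  have [|_ tl] := andP (XP _ t2X t _); first by apply/andP; split; lra.
  apply: le_trans tl _; rewrite exprS -mulrA.
  apply: ler_pM => //.
  - by rewrite ltW// ell0// (le_trans X1).
  - by apply: IH; rewrite t2X ler_pdivrMr// mulrAC -exprSr.
pose g (t : R) := J (Num.max t X) - J X.
have gmono (x y : R) : x <= y -> g x <= g y.
  move=> xy; rewrite lerD2r; apply: (slow_primitive_mono S).
    by rewrite le_max X1 orbT.
  by rewrite ge_max !le_max xy lexx !orbT.
have gJ (t : R) : X <= t -> g t = J t - J X by move=> Xt; rewrite /g max_l.
have g0 (t : R) : 0 <= g t.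
  have -> : 0 = g X by rewrite gJ// subrr.
  have [/gmono//|/ltW tX] := leP X t.
  by rewrite /g (max_r tX) maxxx.
have glip n (x y : R) : x <= y <= 2 ^+ n * X ->
    g y - g x <= 2 ^+ n * ell X / X * (y - x).
  move=> /andP[xy yX].
  have K0 : 0 <= 2 ^+ n * ell X / X by rewrite !mulr_ge0 ?invr_ge0// ltW// ell0.
  have -> : g y - g x = J (Num.max y X) - J (Num.max x X) by rewrite /g; ring.
  have mxy : Num.max x X <= Num.max y X.
    by rewrite ge_max !le_max xy lexx !orbT.
  have Xmx : X <= Num.max x X by rewrite le_max lexx orbT.
  apply: (@le_trans _ _ (2 ^+ n * ell X * (ln (Num.max y X) - ln (Num.max x X)))).
    apply: Jub => //; first exact: le_trans X1 _.
    move=> s /andP[xs sy]; apply: bd; rewrite (le_trans Xmx xs)/=.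
    rewrite (le_trans sy)// ge_max yX ler_peMl// exprn_ege1// ler1n//.
  have -> : 2 ^+ n * ell X / X * (y - x) = 2 ^+ n * ell X * ((y - x) / X) by ring.
  apply: ler_wpM2l; first by rewrite mulr_ge0// ltW// ell0.
  apply: le_trans (ln_increment_le (lt_le_trans X0 Xmx) mxy) _.
  apply: ler_pM.
  - by rewrite subr_ge0.
  - by rewrite invr_ge0 (le_trans X0').
  - by rewrite /Num.max; case: ltP => ?; case: ltP => ?; lra.
  - by rewrite lef_pV2// posrE (lt_le_trans X0).
have cg : continuous g.
  move=> t; apply/cvgrPdist_le => e e0.
  pose n := Num.truncn ((`|t| + 1) / X); pose K := 2 ^+ n.+1 * ell X / X.
  have tX : t + 1 <= 2 ^+ n.+1 * X.
    rewrite -ler_pdivrMr//; apply: (@le_trans _ _ ((`|t| + 1) / X)).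
      by rewrite ler_pM2r ?invr_gt0// lerD2r ler_norm.
    apply: le_trans (ltW (truncnS_gt _)) _.
    by rewrite -natrX ler_nat ltnW// ltn_expl.
  have K0 : 0 < K by rewrite !mulr_gt0 ?invr_gt0 ?exprn_gt0 ?ell0.
  near=> s.
  have st1 : `|t - s| < 1.
    by near: s; exact: (nbhsx_ballx t 1 ltr01).
  have steK : `|t - s| < e / K.
    by near: s; apply: (nbhsx_ballx t (e / K)); rewrite divr_gt0.
  have sX : s <= 2 ^+ n.+1 * X.
    by apply: le_trans tX; move: st1; rewrite ltr_norml => /andP[? ?]; lra.
  have tX' : t <= 2 ^+ n.+1 * X by apply: le_trans tX; rewrite lerDl.
  have bnd : K * `|t - s| <= e by rewrite mulrC -ler_pdivlMr// ltW.
  apply: le_trans bnd.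
  have [ts|/ltW st] := leP t s.
    rewrite distrC (distrC t) !ger0_norm ?subr_ge0// ?gmono//.
    by apply: glip; rewrite ts.
  rewrite !ger0_norm ?subr_ge0// ?gmono//.
  by apply: glip; rewrite st.
have [F FP] := continuous_primitive (-1) cg.
pose I (t : R) := F (t + 1) - F t; pose I' (t : R) := g (t + 1) - g t.
have IP (t : R) : 0 <= t -> is_derive t 1 I (I' t).
  move=> t0; apply: is_deriveB; last by apply: FP; lra.
  have := @is_derive_affine _ F 1 1 t (g (t + 1)); rewrite mul1r mulr1.
  under eq_fun do rewrite mul1r.
  by apply; apply: FP; lra.
have Ibd (t : R) : 0 <= t -> g t <= I t <= g (t + 1).
  move=> t0.
  have [] := @MVT R F g t (t + 1).
  - by rewrite ltrDl.
  - by move=> s; rewrite in_itv/= => /andP[ts _]; apply: FP; lra.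
  - apply: derivable_within_continuous => s; rewrite in_itv/= => /andP[ts _].
    by have := FP s; case; first lra.
  move=> s; rewrite in_itv/= => /andP[ts st]; rewrite addrAC subrr add0r mulr1.
  by rewrite -/(I t) => ->; rewrite !gmono// ltW.
exists I, I', (J X); split => //.
- move=> t; apply: cvgB; last exact: cg.
  apply: (@continuous_comp _ _ _ (fun t : R => t + 1) g); last exact: cg.
  by apply: cvgD; [exact: cvg_id|exact: cvg_cst].
- split; last by move=> t /Ibd/andP[+ _]; apply: le_trans.
  have := Ibd 0 (lexx _); rewrite add0r.
  by rewrite /g !max_r// ?subrr -?eq_le => // /eqP.
- have H := slow_primitive_unit_step S; near=> t.
  have H' : J (t + 1) - J t <= 2 * ell t / t by near: t.
  have Xt : X <= t by near: t; apply: nbhs_pinfty_ge; exact: num_real.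
  have t0 : 0 <= t by rewrite (le_trans X0').
  have := Ibd t t0; rewrite !gJ//; last by rewrite (le_trans Xt)// lerDl.
  move=> /andP[i1 i2]; rewrite ger0_norm ?subr_ge0//; lra.
- have H := slow_primitive_unit_step S; near=> t.
  have H' : J (t + 1) - J t <= 2 * ell t / t by near: t.
  have Xt : X <= t by near: t; apply: nbhs_pinfty_ge; exact: num_real.
  have tt : t <= t + 1 by rewrite lerDl.
  rewrite ger0_norm /I' ?subr_ge0 ?gmono// !gJ//; first lra.
  by rewrite (le_trans Xt)// lerDl.
Unshelve. all: by end_near.
Qed.

(** * Uniqueness for the pantograph equation *)

Lemma halfline_derivativeB (R : realType) (w z : R -> R) (t l m : R) :
  halfline_derivative w t l -> halfline_derivative z t m ->
  halfline_derivative (fun s => w s - z s) t (l - m).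
Proof.
rewrite /halfline_derivative => wl zm.
have -> : (fun s => (w s - z s - (w t - z t)) / (s - t)) =
    (fun s => (w s - w t) / (s - t) - (z s - z t) / (s - t)).
  by apply/funext => s; rewrite -mulrBl; congr (_ / _); ring.
exact: cvgB.
Qed.

Lemma is_derive_halfline (R : realType) (z : R -> R) (t l : R) :
  is_derive t 1 z l -> halfline_derivative z t l.
Proof.
move=> [dz zl]; apply: cvg_within_filter.
have : h^-1 *: (z (h *: 1 + t) - z t) @[h --> 0^'] --> l.
  by rewrite -zl; exact: dz.
move=> /cvgrPdist_lt zd; apply/cvgrPdist_lt => e e0.
have [r /= r0 rP] := zd e e0.
exists r => //= s st s_t.
have := rP (s - t); rewrite /ball/= sub0r normrN distrC => /(_ st).
rewrite subr_eq0 => /(_ s_t).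
by rewrite [(s - t) *: 1]mulr1 subrK mulrC.
Qed.

(** At a positive maximum [d c] over [0, t] the equation gives a derivative of
    at most [(a + b) * d c], which is negative, so [d] takes larger values
    immediately to the left of [c]. *)
Lemma homogeneous_pantograph_le0 (R : realType) (q a b : R) (d : R -> R) :
  0 < q -> q < 1 -> 0 < a -> a + b < 0 ->
  {within `[0, +oo[%classic, continuous d} ->
  (forall t : R, 0 <= t -> halfline_derivative d t (a * d (q * t) + b * d t)) ->
  d 0 <= 0 -> forall t : R, 0 <= t -> d t <= 0.
Proof.
move=> q0 q1 a0 ab cd dd d0 t t0.
have cdt : {within `[0, t], continuous d}.
  apply: continuous_subspaceW cd => s /=.
  by rewrite !in_itv/= andbT => /andP[].
have [c] := EVT_max t0 cdt; rewrite in_itv/= => /andP[c0 ct] cmax.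
have : d t <= d c by apply: cmax; rewrite in_itv/= t0 lexx.
move=> /le_trans; apply; rewrite leNgt; apply/negP => dc.
have c0' : 0 < c.
  rewrite lt_neqAle c0 andbT; apply: contraTneq dc => <-.
  by rewrite -leNgt.
have qc : d (q * c) <= d c.
  apply: cmax; rewrite in_itv/= mulr_ge0 ?(ltW q0)//=.
  by rewrite (le_trans _ ct)// ger_pMl// ltW.
have neg : a * d (q * c) + b * d c < 0.
  have := ler_wpM2l (ltW a0) qc; have := ltr_pM2r dc (a + b) 0; rewrite ab mul0r.
  by move=> + ?; lra.
have := dd c c0; move=> /cvgr_lt/(_ 0 neg) [r /= r0 rP].
(* a point to the left of c where the difference quotient is nonnegative *)
pose s := Num.max 0 (c - r / 2).
have sc : s < c by rewrite gt_max c0'/= ltrBlDr ltrDl divr_gt0.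
have s0 : 0 <= s by rewrite le_max lexx.
have scr : `|c - s| < r.
  rewrite ger0_norm ?subr_ge0 ?ltW//.
  have : c - r / 2 <= s by rewrite le_max lexx orbT.
  by lra.
have := rP s scr; rewrite lt_eqF// in_itv/= s0 => /(_ isT isT).
apply/negP; rewrite -leNgt mulr_le0//.
  by rewrite subr_le0 cmax// in_itv/= s0 (le_trans (ltW sc)).
by rewrite invr_le0 subr_le0 ltW.
Qed.

Lemma pantograph_uniqueness (R : realType) (q a b xi : R) (phi w z : R -> R) :
  0 < q -> q < 1 -> 0 < a -> a + b < 0 ->
  pantograph_solution q a b phi xi w -> pantograph_solution q a b phi xi z ->
  forall t : R, 0 <= t -> w t = z t.
Proof.
move=> q0 q1 a0 ab.
have le (w' z' : R -> R) : pantograph_solution q a b phi xi w' ->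
    pantograph_solution q a b phi xi z' -> forall t : R, 0 <= t -> w' t <= z' t.
  move=> [cw dw w0] [cz dz z0] t t0; rewrite -subr_le0.
  apply: (@homogeneous_pantograph_le0 R q a b (fun s => w' s - z' s)) => //.
  - by move=> s; apply: cvgB; [exact: cw|exact: cz].
  - move=> s s0.
    have -> : a * (w' (q * s) - z' (q * s)) + b * (w' s - z' s) =
       (a * w' (q * s) + b * w' s + phi s) - (a * z' (q * s) + b * z' s + phi s).
      by ring.
    exact: halfline_derivativeB (dw s s0) (dz s s0).
  - by rewrite w0 z0 subrr.
move=> ws zs t t0; apply/eqP; rewrite eq_le; apply/andP; split; exact: le.
Qed.

(** * The trial profile and its increments *)

Lemma cvg0_le (R : realType) (f g : R -> R) (M : R) :
  (\forall t \near +oo, `|f t| <= M * g t) -> g t @[t --> +oo] --> 0 ->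
  f t @[t --> +oo] --> 0.
Proof.
move=> fg g0; apply: norm_cvg0.
apply: (@squeeze_cvgr _ _ _ _ (cst 0) (fun t => M * g t)).
- by near=> t; rewrite normr_ge0/=; near: t.
- exact: cvg_cst.
- by rewrite -(mulr0 M); apply: cvgM => //; exact: cvg_cst.
Unshelve. all: by end_near. Qed.

Lemma cvg_inv_pinfty (R : realType) : t^-1 @[t --> +oo] --> (0 : R).
Proof.
apply/(gtr0_cvgV0 (f := id)); last exact: cvg_id.
by near=> t; near: t; apply: nbhs_pinfty_gt; exact: num_real.
Unshelve. all: by end_near. Qed.

Lemma cvg_pinfty_scale (R : realType) (f : R -> R) (q l : R) : 0 < q ->
  f t @[t --> +oo] --> l -> f (q * t) @[t --> +oo] --> l.
Proof.
move=> q0 fl; apply: (cvg_comp ( *%R q) f) fl.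
apply/cvgryPge => A; near=> t.
have At : q^-1 * A <= t by near: t; apply: nbhs_pinfty_ge; exact: num_real.
by rewrite -ler_pdivrMl.
Unshelve. all: by end_near. Qed.

Lemma powR_cvg1 (R : realType) (k : R) (f : R -> R) :
  f t @[t --> +oo] --> (1 : R) -> f t `^ k @[t --> +oo] --> (1 : R).
Proof.
move=> f1.
have -> : (1 : R) = 1 `^ k by rewrite powR1.
have c1 := is_derive_cvg (is_derive1_powR k (@ltr01 R)).
exact: (cvg_comp f (fun x => x `^ k) f1 c1).
Qed.

(** Bernoulli's inequality for a nonpositive exponent. *)
Lemma powR_gap (R : realType) (k y : R) : k <= 0 -> 0 <= y ->
  0 <= 1 - (1 + y) `^ k <= - k * y.
Proof.
move=> k0 y0.
have y1 : 0 < 1 + y by rewrite ltr_pwDl.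
have kl : k * y <= k * ln (1 + y).
  by apply: ler_wnM2l => //; apply: le_ln1Dx; lra.
have kl0 : k * ln (1 + y) <= 0 by rewrite mulr_le0_ge0// ln_ge0// lerDl.
rewrite /powR gt_eqF//.
have := expR_ge1Dx (k * ln (1 + y)).
have : expR (k * ln (1 + y)) <= 1 by rewrite expR_le1.
by move=> ? ?; apply/andP; split; lra.
Qed.

(** The slowly varying factor of the solution: the first term gives the initial
    value, the second one is bounded and only serves to make the limit positive,
    the third one carries the growth. *)
Definition profile (R : realType) (xi K D : R) (I : R -> R) (t : R) : R :=
  xi + K * (t / (1 + t)) + D * I t.

Definition profile_derivative (R : realType) (K D : R) (I' : R -> R) (t : R) : R :=
  K / (1 + t) ^+ 2 + D * I' t.

Section profile_estimates.
Context (R : realType) (ell J I I' : R -> R) (c xi K D : R).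
Context (S : slow_primitive ell J)
  (IJ : \forall t \near +oo, `|I t - (J t - c)| <= 2 * ell t / t)
  (I'l : \forall t \near +oo, `|I' t| <= 2 * ell t / t)
  (K0 : 0 <= K) (D0 : 0 <= D).

Let u := profile xi K D I.
Let u' := profile_derivative K D I'.
Let s (t : R) := (1 + J t) / (t * ell t) + t^-1.

Let s0 : s t @[t --> +oo] --> 0.
Proof.
rewrite -[X in _ --> X](addr0 0); apply: cvgD.
  exact: slow_primitive_sublinear.
exact: cvg_inv_pinfty.
Qed.

Let J0 (t : R) : 1 <= t -> 0 <= J t.
Proof.
by move=> t1; have [_ _ /le_trans + _ _] := S; apply; apply: slow_primitive_mono S _ _ _ _.
Qed.

Let sE (t : R) : 1 <= t -> s t * (t * ell t) = 1 + J t + ell t.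
Proof.
move=> t1; have [/(_ t t1) l0 _ _ _ _] := S.
by rewrite /s; field; rewrite !gt_eqF// (lt_le_trans _ t1).
Qed.

Let tfrac (t : R) : 1 <= t -> 0 <= t / (1 + t) <= 1.
Proof.
move=> t1; have t0 : 0 < 1 + t by lra.
by apply/andP; split; [apply: divr_ge0; lra|rewrite ler_pdivrMr//; lra].
Qed.

(** This is the smallness of t^(kappa-1) u(t) relative to gamma(t). *)
Lemma profile_sublinear : u t / (t * ell t) @[t --> +oo] --> 0.
Proof.
apply: (@cvg0_le _ _ s (`|xi| + K + D * (3 + `|c|))) s0.
near=> t.
have t1 : 1 <= t by near: t; apply: nbhs_pinfty_ge; exact: num_real.
have t0 : 0 < t by rewrite (lt_le_trans _ t1).
have l0 : 0 < ell t by have [/(_ t t1)] := S.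
have tl0 : 0 < t * ell t by exact: mulr_gt0.
rewrite normrM normfV (gtr0_norm tl0) ler_pdivrMr// -mulrA sE//.
have Il : `|I t| <= 2 * ell t + (J t + `|c|).
  have H : `|I t - (J t - c)| <= 2 * ell t / t by near: t.
  have H2 : 2 * ell t / t <= 2 * ell t.
    by rewrite ler_pdivrMr// ler_peMr// mulr_ge0// ltW.
  have := ler_normD (I t - (J t - c)) (J t - c); rewrite subrK.
  have := ler_normB (J t) c; rewrite (ger0_norm (J0 t1)); lra.
have /andP[f0 f1] := tfrac t1.
apply: (@le_trans _ _ (`|xi| + K + D * (2 * ell t + (J t + `|c|)))).
  apply: (le_trans (ler_normD _ _)); apply: lerD.
    apply: (le_trans (ler_normD _ _)); rewrite lerD2l.
    by rewrite ger0_norm; [rewrite ler_piMr|exact: mulr_ge0].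
  by rewrite normrM ger0_norm// ler_wpM2l.
have x0 := normr_ge0 xi; have c0 := normr_ge0 c; have := J0 t1.
move=> j0.
have h1 := mulr_ge0 (addr_ge0 x0 K0) (addr_ge0 j0 (ltW l0)).
have h2 := mulr_ge0 D0 (mulr_ge0 c0 (addr_ge0 j0 (ltW l0))).
have h3 := mulr_ge0 D0 j0; have h4 := mulr_ge0 D0 (ltW l0).
rewrite -subr_ge0.
have -> : (`|xi| + K + D * (3 + `|c|)) * (1 + J t + ell t) -
  (`|xi| + K + D * (2 * ell t + (J t + `|c|))) =
  (`|xi| + K) * (J t + ell t) + D * (`|c| * (J t + ell t)) + 2 * (D * J t) + D * ell t + 3 * D by ring.
by rewrite !addr_ge0// mulr_ge0.
Unshelve. all: by end_near. Qed.

Lemma profile_derivative_small : u' t / ell t @[t --> +oo] --> 0.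
Proof.
apply: (@cvg0_le _ _ s (K + 2 * D)) s0.
near=> t.
have t1 : 1 <= t by near: t; apply: nbhs_pinfty_ge; exact: num_real.
have t0 : 0 < t by rewrite (lt_le_trans _ t1).
have l0 : 0 < ell t by have [/(_ t t1)] := S.
rewrite normrM normfV (gtr0_norm l0) ler_pdivrMr//.
have H : `|I' t| <= 2 * ell t / t by near: t.
have -> : (K + 2 * D) * s t * ell t = (K + 2 * D) * ((1 + J t) / t + ell t / t).
  by rewrite /s; field; rewrite !gt_eqF.
have inv : (1 + t) ^- 2 <= (1 + J t) / t.
  rewrite ler_pdivlMr// mulrC ler_pdivrMr ?exprn_gt0//; last by lra.
  have j0 := J0 t1.
  apply: (@le_trans _ _ (1 * (1 + t) ^+ 2)).
    by rewrite mul1r expr2; have := mulr_ge0 (ltW t0) (ltW t0); lra.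
  by apply: ler_wpM2r; [exact: exprn_ge0 (addr_ge0 _ (ltW t0))|lra].
apply: (le_trans (ler_normD _ _)).
have -> : (K + 2 * D) * ((1 + J t) / t + ell t / t) =
   K * ((1 + J t) / t) + D * (2 * ell t / t) + (K * (ell t / t) + 2 * D * ((1 + J t) / t)) by ring.
have j0 := J0 t1; have t0' := ltW t0; have l0' := ltW l0.
rewrite -[leLHS]addr0; apply: lerD.
  apply: lerD; last by rewrite normrM ger0_norm// ler_wpM2l.
  rewrite ger0_norm; first by rewrite ler_wpM2l.
  by rewrite mulr_ge0// invr_ge0 exprn_ge0// addr_ge0.
by rewrite addr_ge0// !mulr_ge0// ?invr_ge0// ?addr_ge0.
Unshelve. all: by end_near. Qed.

Lemma profile_increment (q : R) : 0 < q -> q < 1 ->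
  (u t - u (q * t)) / ell t @[t --> +oo] --> D * ln q^-1.
Proof.
move=> q0 q1.
pose v (t : R) := (I t - (J t - c)) / ell t.
have v0 : v t @[t --> +oo] --> 0.
  apply: (@cvg0_le _ _ (fun t => t^-1) 2); last exact: cvg_inv_pinfty.
  near=> t.
  have t1 : 1 <= t by near: t; apply: nbhs_pinfty_ge; exact: num_real.
  have l0 : 0 < ell t by have [/(_ t t1)] := S.
  rewrite /v normrM normfV (gtr0_norm l0) ler_pdivrMr// mulrAC.
  by near: t.
have w0 : K * (t / (1 + t) - q * t / (1 + q * t)) / ell t @[t --> +oo] --> 0.
  apply: (@cvg0_le _ _ s (K / q)) s0.
  near=> t.
  have t1 : 1 <= t by near: t; apply: nbhs_pinfty_ge; exact: num_real.
  have t0 : 0 < t by rewrite (lt_le_trans _ t1).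
  have l0 : 0 < ell t by have [/(_ t t1)] := S.
  have j0 := J0 t1; have t0' := ltW t0; have l0' := ltW l0.
  have qt0 : 0 < q * t by exact: mulr_gt0.
  have fE : t / (1 + t) - q * t / (1 + q * t) = (1 - q) * t / ((1 + t) * (1 + q * t)).
    by field; rewrite !gt_eqF//; lra.
  have f0 : 0 <= t / (1 + t) - q * t / (1 + q * t).
    by rewrite fE divr_ge0// mulr_ge0//; lra.
  have fb : t / (1 + t) - q * t / (1 + q * t) <= q^-1 / t.
    rewrite fE -invfM ler_pdivrMr; last by rewrite mulr_gt0; lra.
    rewrite ler_pdivlMl//.
    have := mulr_ge0 (ltW qt0) (ltW qt0); have := mulr_ge0 (ltW qt0) t0'.
    have := mulr_ge0 (mulr_ge0 (ltW qt0) t0') (ltW q0).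
    by lra.
  rewrite ger0_norm; last by rewrite divr_ge0// mulr_ge0.
  rewrite ler_pdivrMr//.
  have -> : K / q * s t * ell t = K * (q^-1 * (1 + J t) / t + q^-1 * ell t / t).
    by rewrite /s; field; rewrite !gt_eqF.
  apply: ler_wpM2l => //; apply: (le_trans fb).
  rewrite -mulrDl ler_pM2r ?invr_gt0// -mulrDr ler_peMr ?invr_ge0 ?ltW//; lra.
(* the smoothing error at q t, in units of ell at t *)
have vq0 : v (q * t) * (ell (q * t) / ell t) @[t --> +oo] --> 0.
  rewrite -(mulr1 0); apply: cvgM; first exact: cvg_pinfty_scale.
  exact: slow_ratio S q0 q1.
have -> : D * ln q^-1 = 0 + D * (0 - 0 + ln q^-1) by ring.
apply: (@cvg_pinfty_eq _ (fun t => K * (t / (1 + t) - q * t / (1 + q * t)) / ell t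
  + D * (v t - v (q * t) * (ell (q * t) / ell t) + (J t - J (q * t)) / ell t))).
  near=> t.
  have t1 : 1 <= t by near: t; apply: nbhs_pinfty_ge; exact: num_real.
  have qt1 : q^-1 <= t by near: t; apply: nbhs_pinfty_ge; exact: num_real.
  have t0 : 0 < t by rewrite (lt_le_trans _ t1).
  have qt1' : 1 <= q * t by rewrite -ler_pdivrMl// mulr1.
  have l0 : 0 < ell t by have [/(_ t t1)] := S.
  have lq0 : 0 < ell (q * t) by have [/(_ _ qt1')] := S.
  by rewrite /u /profile /v; field; rewrite !gt_eqF//; lra.
apply: cvgD => //; apply: cvgM; first exact: cvg_cst.
apply: cvgD; first exact: cvgB.
exact: slow_primitive_increment S q0 q1.
Unshelve. all: by end_near. Qed.

End profile_estimates.

(** * Asymptotics of the forcing term *)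

Lemma powR_shift_factor (R : realType) (k t : R) : 0 < t ->
  (1 + t) `^ k = t `^ k * ((1 + t) / t) `^ k.
Proof.
move=> t0; rewrite -powRM ?(ltW t0)//; last by apply: divr_ge0; lra.
by congr (_ `^ _); field; rewrite gt_eqF.
Qed.

Lemma powR_shift_ratio (R : realType) (k : R) :
  ((1 + t) / t) `^ k @[t --> +oo] --> (1 : R).
Proof.
apply: powR_cvg1; rewrite -[X in _ --> X](addr0 1).
apply: (@cvg_pinfty_eq _ (fun t => 1 + t^-1)).
  near=> t.
  have t0 : 0 < t by near: t; apply: nbhs_pinfty_gt; exact: num_real.
  by field; rewrite gt_eqF.
by apply: cvgD; [exact: cvg_cst|exact: cvg_inv_pinfty].
Unshelve. all: by end_near. Qed.

(** As [a * q `^ k = - b], replacing t^k by (1 + t)^k, which is smooth at 0,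
    destroys the exact cancellation only by a relative error O(1/t). *)
Lemma powR_cancellation (R : realType) (q a b k t : R) :
  0 < q -> q < 1 -> 0 < a -> b < 0 -> k <= 0 -> a * q `^ k = - b -> 1 <= t ->
  `|q * t * (- b - a * ((1 + q * t) / (1 + t)) `^ k)| <= b * k.
Proof.
move=> q0 q1 a0 b0 k0 aq t1.
have t0 : 0 < t by rewrite (lt_le_trans _ t1).
pose y := (1 - q) / (q * (1 + t)).
have y0 : 0 <= y by rewrite divr_ge0 ?mulr_ge0//; lra.
have -> : (1 + q * t) / (1 + t) = q * (1 + y).
  by rewrite /y; field; rewrite !gt_eqF//; lra.
rewrite powRM; [|lra|lra]; rewrite mulrA aq.
have -> : q * t * (- b - - b * (1 + y) `^ k) = (- b) * (q * t * (1 - (1 + y) `^ k)).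
  by ring.
have /andP[g0 g1] := powR_gap k0 y0.
rewrite ger0_norm; last by rewrite mulr_ge0 ?mulr_ge0//; lra.
have -> : b * k = - b * - k by ring.
apply: ler_wpM2l; first lra.
have qt0 : 0 <= q * t by rewrite mulr_ge0; lra.
apply: le_trans (ler_wpM2l qt0 g1) _.
have -> : q * t * (- k * y) = - k * ((1 - q) * t / (1 + t)).
  by rewrite /y; field; rewrite !gt_eqF//; lra.
rewrite ler_piMr//; first lra.
by rewrite ler_pdivrMr; [have := mulr_ge0 (ltW q0) (ltW t0); lra|lra].
Qed.

(** The numerator is z'(t) - a z(qt) - b z(t) for z(t) = (1 + t)^k u(t). After
    division by t^k ell(t) it is ((1 + t)/t)^k times a sum of four terms, of which
    only the one with the increment u(t) - u(qt) does not vanish at infinity. *)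
Lemma pantograph_residual_asymptotics (R : realType) (ell : R -> R)
    (u u' : R -> R) (q a b k d : R) :
  (forall t, 1 <= t -> 0 < ell t) ->
  0 < q -> q < 1 -> 0 < a -> b < 0 -> k <= 0 -> a * q `^ k = - b ->
  ell (q * t) / ell t @[t --> +oo] --> (1 : R) ->
  u t / (t * ell t) @[t --> +oo] --> 0 ->
  u' t / ell t @[t --> +oo] --> 0 ->
  (u t - u (q * t)) / ell t @[t --> +oo] --> d ->
  (k * (1 + t) `^ (k - 1) * u t + (1 + t) `^ k * u' t
     - a * ((1 + q * t) `^ k * u (q * t)) - b * ((1 + t) `^ k * u t))
   / (t `^ k * ell t) @[t --> +oo] --> - b * d.
Proof.
move=> ell0 q0 q1 a0 b0 k0 aq lq ul u'l du.
pose v (t : R) := u t / (t * ell t).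
have vq : v (q * t) @[t --> +oo] --> 0 by apply: cvg_pinfty_scale.
pose B (t : R) := q * t * (- b - a * ((1 + q * t) / (1 + t)) `^ k).
have T1 : k * v t * (t / (1 + t)) @[t --> +oo] --> 0.
  apply: (@cvg0_le _ _ (fun t => `|v t|) `|k|); last first.
    by rewrite -(normr0 R); exact: cvg_norm.
  near=> t.
  have t0 : 0 < t by near: t; apply: nbhs_pinfty_gt; exact: num_real.
  rewrite !normrM -mulrA ler_wpM2l// ler_piMr// -normrM ger0_norm.
    by rewrite ler_pdivrMr; lra.
  by rewrite divr_ge0; lra.
have T4 : v (q * t) * (ell (q * t) / ell t) * B t @[t --> +oo] --> 0.
  apply: (@cvg0_le _ _ (fun t => `|v (q * t) * (ell (q * t) / ell t)|) (b * k)); last first.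
    rewrite -(normr0 R) -(mulr1 0); apply: cvg_norm.
    exact: cvgM.
  near=> t.
  have t1 : 1 <= t by near: t; apply: nbhs_pinfty_ge; exact: num_real.
  rewrite normrM mulrC ler_wpM2r//.
  exact: powR_cancellation.
have -> : - b * d = 1 * (0 + 0 + (- b) * d + 0) by ring.
apply: (@cvg_pinfty_eq _ (fun t => ((1 + t) / t) `^ k *
  (k * v t * (t / (1 + t)) + u' t / ell t + (- b) * ((u t - u (q * t)) / ell t)
    + v (q * t) * (ell (q * t) / ell t) * B t))).
  near=> t.
  have t1 : 1 <= t by near: t; apply: nbhs_pinfty_ge; exact: num_real.
  have qt1 : q^-1 <= t by near: t; apply: nbhs_pinfty_ge; exact: num_real.
  have t0 : 0 < t by rewrite (lt_le_trans _ t1).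
  have qt1' : 1 <= q * t by rewrite -ler_pdivrMl// mulr1.
  have l0 := ell0 _ t1; have lq0 := ell0 _ qt1'.
  have p0 : 0 < 1 + t by lra.
  have Tk := powR_gt0 k t0.
  have E1 := powR_shift_factor k t0.
  have E2 : (1 + q * t) `^ k = t `^ k * ((1 + t) / t) `^ k * ((1 + q * t) / (1 + t)) `^ k.
    rewrite -E1 -powRM; [|exact: ltW|by rewrite divr_ge0//; lra].
    by congr (_ `^ _); field; rewrite gt_eqF.
  have E3 : (1 + t) `^ (k - 1) = t `^ k * ((1 + t) / t) `^ k / (1 + t).
    rewrite -E1 powRB; last by rewrite (gt_eqF p0) implybT.
    by rewrite powRr1// ltW.
  rewrite E1 E2 E3 /v /B; field.
  by rewrite !gt_eqF.
apply: cvgM; first exact: powR_shift_ratio.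
apply: cvgD => //; apply: cvgD; first exact: cvgD.
by apply: cvgM => //; exact: cvg_cst.
Unshelve. all: by end_near. Qed.

(** * Growth of the trial solution *)

(** [J t] dominates its increment over [t / 2, t], which is of order [ell t]. *)
Lemma slow_le_primitive (R : realType) (ell J : R -> R) :
  slow_primitive ell J -> \forall t \near +oo, ell t <= 2 / ln 2 * J t.
Proof.
move=> S; have [ell0 _ J1 _ _] := S.
have q0 : 0 < 2^-1 :> R by lra.
have q1 : 2^-1 < 1 :> R by lra.
have l2 : 0 < ln 2 :> R by rewrite ln_gt0//; lra.
have := slow_primitive_increment S q0 q1; rewrite invrK.
move=> /cvgr_ge/(_ (ln 2 / 2)) H.
have {}H : \forall t \near +oo, ln 2 / 2 <= (J t - J (2^-1 * t)) / ell t.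
  by apply: H; lra.
near=> t.
have t2 : 2 <= t by near: t; apply: nbhs_pinfty_ge; exact: num_real.
have t1 : 1 <= t by lra.
have l0 := ell0 _ t1.
have : ln 2 / 2 <= (J t - J (2^-1 * t)) / ell t by near: t.
rewrite ler_pdivlMr// => lJ.
have Jq : 0 <= J (2^-1 * t).
  by apply: le_trans J1 _; apply: (slow_primitive_mono S) => //; lra.
by rewrite -[2 / ln 2]invf_div ler_pdivlMl ?divr_gt0//; lra.
Unshelve. all: by end_near. Qed.

Lemma pinfty_bounded_cvg (R : realType) (J : R -> R) (B : R) :
  (forall x y, 1 <= x -> x <= y -> J x <= J y) -> (forall t, 1 <= t -> J t <= B) ->
  exists l, J t @[t --> +oo] --> l /\ forall t, 1 <= t -> J t <= l.
Proof.
move=> Jm JB; pose J' (t : R) := J (Num.max 1 t).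
have nd : {homo J' : x y / x <= y}.
  move=> x y xy; apply: Jm; first by rewrite le_max lexx.
  by rewrite ge_max !le_max lexx xy orbT.
have ub : has_ubound (range J').
  by exists B => _ [t _ <-]; apply: JB; rewrite le_max lexx.
exists (sup (range J')); split.
  apply: cvg_pinfty_eq (nondecreasing_cvgr nd ub).
  near=> t.
  have t1 : 1 <= t by near: t; apply: nbhs_pinfty_ge; exact: num_real.
  by rewrite /J' max_r.
move=> t t1; apply: ub_le_sup => //; exists t => //.
by rewrite /J' max_r.
Unshelve. all: by end_near. Qed.

Section profile_growth.
Context (R : realType) (ell J I : R -> R) (c xi K D k : R).
Context (S : slow_primitive ell J)
  (IJ : \forall t \near +oo, `|I t - (J t - c)| <= 2 * ell t / t)
  (I0 : forall t : R, 0 <= t -> 0 <= I t)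
  (KE : K = `|xi| + 1) (D0 : 0 < D).

Let u := profile xi K D I.
Let z (t : R) := (1 + t) `^ k * u t.

Let tfrac : t / (1 + t) @[t --> +oo] --> (1 : R).
Proof.
have H : (1 + t^-1)^-1 @[t --> +oo] --> (1 : R).
  rewrite -[X in _ --> X]invr1; apply: cvgV; first exact: oner_neq0.
  rewrite -[X in _ --> X](addr0 1).
  by apply: cvgD; [exact: cvg_cst|exact: cvg_inv_pinfty].
apply: cvg_pinfty_eq H; near=> t.
have t0 : 0 < t by near: t; apply: nbhs_pinfty_gt; exact: num_real.
by field; rewrite !gt_eqF//; lra.
Unshelve. all: by end_near. Qed.

(** [K] exceeds [- xi], and I is nonnegative with limit [l - c], so the limit
    [xi + K + D (l - c)] of the profile is positive. *)
Lemma profile_growth_bounded (B : R) : (forall t, 1 <= t -> J t <= B) ->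
  exists l L : R, [/\ 0 < l, 0 < L, J t @[t --> +oo] --> l &
    z t / t `^ k @[t --> +oo] --> L].
Proof.
move=> JB; have Jm := slow_primitive_mono S.
have [l [Jl lJ]] := pinfty_bounded_cvg Jm JB.
have IJ0 : I t - (J t - c) @[t --> +oo] --> 0.
  have H := slow_le_primitive S.
  apply: (@cvg0_le _ _ (fun t => t^-1) (2 * (2 / ln 2 * B))); last exact: cvg_inv_pinfty.
  near=> t.
  have t1 : 1 <= t by near: t; apply: nbhs_pinfty_ge; exact: num_real.
  have t0 : 0 < t by lra.
  have e1 : `|I t - (J t - c)| <= 2 * ell t / t by near: t.
  have e2 : ell t <= 2 / ln 2 * J t by near: t.
  apply: le_trans e1 _; rewrite ler_pM2r ?invr_gt0// ler_pM2l//.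
  apply: le_trans e2 _; apply: ler_wpM2l; last exact: JB.
  by rewrite divr_ge0// ln_ge0//; lra.
have Il : I t @[t --> +oo] --> l - c.
  rewrite -[X in _ --> X]add0r.
  apply: (@cvg_pinfty_eq _ (fun t => I t - (J t - c) + (J t - c))).
    by apply: nearW => t; rewrite subrK.
  by apply: cvgD => //; apply: cvgB => //; exact: cvg_cst.
have lc0 : 0 <= l - c.
  apply: (cvgr_to_ge Il); near=> t.
  by apply: I0; near: t; apply: nbhs_pinfty_ge; exact: num_real.
exists l, (xi + K * 1 + D * (l - c)); split => //.
- have H := slow_le_primitive S; near (+oo : set_system R) => t.
  have t1 : 1 <= t by near: t; apply: nbhs_pinfty_ge; exact: num_real.
  have e2 : ell t <= 2 / ln 2 * J t by near: t.
  have l0 : 0 < ell t by have [/(_ t t1)] := S.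
  have l2 : 0 < ln 2 :> R by rewrite ln_gt0//; lra.
  apply: lt_le_trans (lJ t t1).
  by move: (lt_le_trans l0 e2); rewrite pmulr_rgt0// divr_gt0.
- rewrite KE mulr1; have := ler_norm (- xi); rewrite normrN.
  have := mulr_ge0 (ltW D0) lc0; lra.
- rewrite -[X in _ --> X]mul1r.
  apply: (@cvg_pinfty_eq _ (fun t => ((1 + t) / t) `^ k * u t)).
    near=> t.
    have t0 : 0 < t by near: t; apply: nbhs_pinfty_gt; exact: num_real.
    by rewrite /z powR_shift_factor//; field; rewrite gt_eqF ?powR_gt0.
  apply: cvgM; first exact: powR_shift_ratio.
  apply: cvgD; last by apply: cvgM => //; exact: cvg_cst.
  by apply: cvgD; [exact: cvg_cst|apply: cvgM => //; exact: cvg_cst].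
Unshelve. all: by end_near. Qed.

Lemma profile_growth_unbounded :
  (forall A : R, exists2 t : R, 1 <= t & A < J t) ->
  z t / (t `^ k * J t) @[t --> +oo] --> D.
Proof.
move=> JA; have Jm := slow_primitive_mono S.
have Jy : J t @[t --> +oo] --> +oo.
  apply/cvgryPge => A; have [T T1 TA] := JA A; near=> t.
  have Tt : T <= t by near: t; apply: nbhs_pinfty_ge; exact: num_real.
  by apply: le_trans (ltW TA) _; apply: Jm.
have Jpos : \forall t \near +oo, 0 < J t by move/cvgryPgt : Jy; apply.
have Jinv : (J t)^-1 @[t --> +oo] --> (0 : R) by apply/gtr0_cvgV0.
have IJ0 : (I t - (J t - c)) / J t @[t --> +oo] --> 0.
  have H := slow_le_primitive S.
  apply: (@cvg0_le _ _ (fun t => t^-1) (2 * (2 / ln 2))); last exact: cvg_inv_pinfty.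
  near=> t.
  have t0 : 0 < t by near: t; apply: nbhs_pinfty_gt; exact: num_real.
  have j0 : 0 < J t by near: t.
  have e1 : `|I t - (J t - c)| <= 2 * ell t / t by near: t.
  have e2 : ell t <= 2 / ln 2 * J t by near: t.
  rewrite normrM normfV (gtr0_norm j0) ler_pdivrMr//.
  apply: le_trans e1 _.
  have -> : 2 * (2 / ln 2) / t * J t = 2 * (2 / ln 2 * J t) / t by ring.
  by rewrite ler_pM2r ?invr_gt0// ler_pM2l.
have -> : D = 1 * ((xi + K * 1 - D * c) * 0 + D * 0 + D) by ring.
apply: (@cvg_pinfty_eq _ (fun t => ((1 + t) / t) `^ k *
  ((xi + K * (t / (1 + t)) - D * c) * (J t)^-1 + D * ((I t - (J t - c)) / J t) + D))).
  near=> t.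
  have t0 : 0 < t by near: t; apply: nbhs_pinfty_gt; exact: num_real.
  have t1 : 0 < 1 + t by lra.
  have j0 : 0 < J t by near: t.
  have Tk := powR_gt0 k t0.
  by rewrite /z powR_shift_factor// /u /profile; field; rewrite !gt_eqF.
apply: cvgM; first exact: powR_shift_ratio.
apply: cvgD; last exact: cvg_cst.
apply: cvgD; last by apply: cvgM => //; exact: cvg_cst.
apply: cvgM => //; apply: cvgB; last exact: cvg_cst.
by apply: cvgD; [exact: cvg_cst|apply: cvgM => //; exact: cvg_cst].
Unshelve. all: by end_near. Qed.

End profile_growth.

(** * The construction *)

Lemma pantograph_trial_derive (R : realType) (I : R -> R) (xi K D k t i : R) : 0 <= t ->
  is_derive t 1 I i ->
  is_derive t 1
    (fun t => (1 + t) `^ k * profile xi K D I t)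
    (k * (1 + t) `^ (k - 1) * profile xi K D I t +
     (1 + t) `^ k * (K / (1 + t) ^+ 2 + D * i)).
Proof.
move=> t0 It; have p0 : 0 < 1 + t by lra.
have shift (F : R -> R) (d : R) : is_derive (1 + t) 1 F d ->
    is_derive t 1 (fun t => F (1 + t)) d.
  move=> Fd; have := @is_derive_affine _ F 1 1 t d.
  rewrite mul1r mulr1 addrC => /(_ Fd).
  by under eq_fun do rewrite mul1r addrC.
have P : is_derive t 1 (fun t => (1 + t) `^ k) (k * (1 + t) `^ (k - 1)).
  exact: (shift (fun x => x `^ k) _ (is_derive1_powR k p0)).
have V : is_derive t 1 (fun t => (1 + t)^-1) (- (1 + t) ^- 2).
  have I1 : is_derive t 1 (fun t : R => 1 + t) 1.
    exact: (shift id 1 (is_derive_id _ _)).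
  have := is_deriveV (lt0r_neq0 p0) I1.
  by rewrite [_ *: 1]mulr1.
have Q : is_derive t 1 (fun t => t / (1 + t)) ((1 + t) ^- 2).
  have := is_deriveM (is_derive_id t 1) V.
  rewrite /GRing.scale/=.
  have -> // : t * - (1 + t) ^- 2 + (1 + t)^-1 * 1 = (1 + t) ^- 2.
  by field; rewrite gt_eqF.
have U : is_derive t 1 (profile xi K D I)
    (K / (1 + t) ^+ 2 + D * i).
  have := is_deriveD (is_deriveD (is_derive_cst xi t 1) (is_deriveZ K Q)) (is_deriveZ D It).
  by rewrite add0r.
have := is_deriveM P U.
rewrite addrC /GRing.scale/=; congr (is_derive _ _ _ (_ + _)); exact: mulrC.
Qed.

(** The constant [D] is dictated by the limit - b D ln(1/q) of the forcing term
    relative to t^k ell(t). The last two clauses cover the two possible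
    behaviours of the nondecreasing function [J]. *)
Lemma pantograph_construction (R : realType) (ell J : R -> R)
    (q a b k xi C : R) :
  slow_primitive ell J ->
  0 < q -> q < 1 -> 0 < a -> b < 0 -> a + b < 0 -> k <= 0 ->
  a * q `^ k = - b -> 0 < C ->
  exists phi z : R -> R, [/\ {within `[0, +oo[%classic, continuous phi},
    phi t / (t `^ k * ell t) @[t --> +oo] --> C,
    unique_pantograph_solution q a b phi xi z,
    ((forall A : R, exists2 t : R, 1 <= t & A < J t) ->
      exists2 D : R, 0 < D & z t / (t `^ k * J t) @[t --> +oo] --> D) &
    forall B, (forall t, 1 <= t -> J t <= B) ->
      exists l L : R, [/\ 0 < l, 0 < L, J t @[t --> +oo] --> l &
        z t / t `^ k @[t --> +oo] --> L]].
Proof.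
move=> S q0 q1 a0 b0 ab k0 aq C0.
have [ell0 _ _ _ _] := S.
have [I [I' [c [cI' dI [I0 Ige] IJ I'l]]]] := slow_primitive_smoothing S.
have lq0 : 0 < ln q^-1 by rewrite ln_gt0// invf_gt1.
pose D := C / (- b * ln q^-1); pose K : R := `|xi| + 1.
have D0 : 0 < D by rewrite divr_gt0// mulr_gt0//; lra.
have K0 : 0 <= K by rewrite addr_ge0.
pose u := profile xi K D I.
pose u' := profile_derivative K D I'.
pose z (t : R) := (1 + t) `^ k * u t.
pose z' (t : R) := k * (1 + t) `^ (k - 1) * u t + (1 + t) `^ k * u' t.
pose phi (t : R) := z' t - a * z (q * t) - b * z t.
have dz (t : R) : 0 <= t -> is_derive t 1 z (z' t).
  by move=> t0; apply: pantograph_trial_derive => //; exact: dI.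
have cz (t : R) : 0 <= t -> {for t, continuous z}.
  by move=> t0; exact: is_derive_cvg (dz t t0).
have cz' (t : R) : 0 <= t -> {for t, continuous z'}.
  move=> t0.
  have p0 : 0 < 1 + t by lra.
  have cp : 1 + x @[x --> t] --> 1 + t by apply: cvgD; [exact: cvg_cst|exact: cvg_id].
  have cpow (r : R) : (1 + x) `^ r @[x --> t] --> (1 + t) `^ r.
    apply: (cvg_comp (fun x => 1 + x) (fun y => y `^ r) cp).
    exact: is_derive_cvg (is_derive1_powR r p0).
  have cI : I x @[x --> t] --> I t.
    exact: is_derive_cvg (dI t t0).
  have cu : u x @[x --> t] --> u t.
    apply: cvgD; last by apply: cvgM => //; exact: cvg_cst.
    apply: cvgD; first exact: cvg_cst.
    apply: cvgM; first exact: cvg_cst.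
    apply: cvgM; first exact: cvg_id.
    by apply: cvgV => //; rewrite gt_eqF.
  have cu' : u' x @[x --> t] --> u' t.
    apply: cvgD; last by apply: cvgM; [exact: cvg_cst|exact: cI'].
    apply: cvgM; first exact: cvg_cst.
    apply: cvgV; first by rewrite expf_neq0// gt_eqF.
    exact: (cvgM cp cp).
  apply: cvgD; last exact: cvgM.
  by apply: cvgM => //; apply: cvgM => //; exact: cvg_cst.
have cphi (t : R) : 0 <= t -> {for t, continuous phi}.
  move=> t0; apply: cvgB.
    apply: cvgB; first exact: cz'.
    apply: cvgM; first exact: cvg_cst.
    apply: (@continuous_comp _ _ _ ( *%R q) z); last by apply: cz; rewrite mulr_ge0// ltW.
    by apply: cvgM; [exact: cvg_cst|exact: cvg_id].
  by apply: cvgM; [exact: cvg_cst|exact: cz].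
have sol : pantograph_solution q a b phi xi z.
  split.
  - apply: continuous_in_subspaceT => t; rewrite inE/= in_itv/= andbT; exact: cz.
  - move=> t t0; have -> : a * z (q * t) + b * z t + phi t = z' t.
      by rewrite /phi; ring.
    by apply: is_derive_halfline; exact: dz.
  - by rewrite /z /u /profile I0 !mulr0 mul0r mulr0 !addr0 powR1 mul1r.
exists phi, z; split.
- apply: continuous_in_subspaceT => t; rewrite inE/= in_itv/= andbT; exact: cphi.
- have -> : C = - b * (D * ln q^-1).
    by rewrite /D; field; rewrite gt_eqF//= lt_eqF.
  apply: pantograph_residual_asymptotics => //.
  + exact: slow_ratio S q0 q1.
  + exact: (profile_sublinear xi S IJ K0 (ltW D0)).
  + exact: (profile_derivative_small S I'l K0 (ltW D0)).
  + exact: (profile_increment xi S IJ K0 q0 q1).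
- split => // w ws t t0; exact: pantograph_uniqueness ab ws sol _ t0.
- by move=> JA; exists D => //; exact: (profile_growth_unbounded xi K k S IJ JA).
- by move=> B JB; exact: (profile_growth_bounded k S IJ Ige erefl D0 JB).
Qed.

(** * The theorem *)

(** The uniform convergence theorem for h = ln ell, translated back to ratios.
    A bound by ln(1 + e) on the increments of h suffices on both sides, since
    1/(1 + e) >= 1 - e. *)
Lemma regularly_varying_ratio (R : realType) (kappa : R) (gamma : R -> R) :
  regularly_varying kappa gamma ->
  forall L e : R, 0 < e -> \forall t \near +oo,
    forall l, 1 <= l <= L ->
      (1 - e) * (gamma t / t `^ kappa) <= gamma (l * t) / (l * t) `^ kappa
        <= (1 + e) * (gamma t / t `^ kappa).
Proof.
move=> [g0 gm gl] L e e0.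
pose h (t : R) := ln (gamma t) - kappa * ln t.
have lnell (t : R) : 0 < t -> h t = ln (gamma t / t `^ kappa).
  by move=> t0; rewrite ln_div ?posrE ?powR_gt0 ?g0 ?(ltW t0)// ln_powR.
have hm : lebesgue_measurable_fun `[1, +oo[ h.
  apply: (@measurable_funB _ (lebesgueTypeR R) R `[1, +oo[%classic
    (fun t => ln (gamma t)) (fun t => kappa * ln t)).
    apply: (measurableT_comp (@measurable_ln R)).
    apply: measurable_funS gm; first exact: lebesgueTypeR_itv.
    by move=> t /=; rewrite !in_itv/= !andbT; apply: le_trans.
  apply: lebesgue_measurable_fun_borel => //.
  by apply: measurable_funM => //; apply: measurable_funTS; exact: measurable_ln.
have hl l : 1 <= l -> h (l * t) - h t @[t --> +oo] --> 0.
  move=> l1; have l0 : 0 < l by lra.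
  have lk := powR_gt0 kappa l0.
  have H : ln (gamma (l * t) / gamma t / l `^ kappa) @[t --> +oo] --> 0.
    rewrite -(ln1 R) -(divff (lt0r_neq0 lk)).
    have c1 : {for (l `^ kappa / l `^ kappa), continuous (@ln R)}.
      by apply: continuous_ln; rewrite divr_gt0.
    have rl : gamma (l * t) / gamma t / l `^ kappa @[t --> +oo] -->
        l `^ kappa / l `^ kappa.
      by apply: cvgM; [exact: gl|exact: cvg_cst].
    exact: (cvg_comp (fun t => gamma (l * t) / gamma t / l `^ kappa) _ rl c1).
  apply: cvg_pinfty_eq H; near=> t.
  have t0 : 0 < t by near: t; apply: nbhs_pinfty_gt; exact: num_real.
  have lt0 : 0 < l * t by exact: mulr_gt0.
  have gt0 : 0 < gamma t by rewrite g0 ?ltW.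
  have glt0 : 0 < gamma (l * t) by rewrite g0 ?ltW.
  rewrite /h !ln_div ?posrE ?divr_gt0// ln_powR lnM ?posrE//; ring.
have d0 : 0 < ln (1 + e) by rewrite ln_gt0//; lra.
have H := @lebesgue_uniform_slow_increments R h L hm hl _ d0.
near=> t => l lL.
have t0 : 0 < t by near: t; apply: nbhs_pinfty_gt; exact: num_real.
have l0 : 0 < l by have /andP[] := lL; lra.
have lt0 : 0 < l * t by exact: mulr_gt0.
have : `|h (l * t) - h t| < ln (1 + e).
  by move: l lL {l0 lt0}; near: t.
have x0 : 0 < gamma (l * t) / (l * t) `^ kappa by rewrite divr_gt0 ?powR_gt0 ?g0 ?ltW.
have y0 : 0 < gamma t / t `^ kappa by rewrite divr_gt0 ?powR_gt0 ?g0 ?ltW.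
rewrite !lnell//; move: x0 y0.
set x := gamma (l * t) / _; set y := gamma t / _ => x0 y0; clearbody x y.
have e1 : 0 < 1 + e by lra.
rewrite ltr_norml => /andP[xy yx]; apply/andP; split.
  have yex : y <= (1 + e) * x.
    rewrite -ler_ln ?posrE ?mulr_gt0// lnM ?posrE//; lra.
  have [e1'|e1'] := leP 1 e.
    by apply: (@le_trans _ _ 0); [apply: mulr_le0_ge0; [lra|exact: ltW]|exact: ltW].
  have := ler_wpM2l (_ : 0 <= 1 - e) yex.
  have := mulr_ge0 (mulr_ge0 (ltW e0) (ltW e0)) (ltW x0).
  move=> ? /(_ ltac:(lra)); lra.
by rewrite -ler_ln ?posrE ?mulr_gt0// lnM ?posrE//; lra.
Unshelve. all: by end_near. Qed.

(** The integrand gamma(s)/s^(kappa+1) is ell(s)/s with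
    ell(s) = gamma(s)/s^kappa. *)
Lemma regularly_varying_slow_primitive (R : realType) (kappa : R)
    (gamma : R -> R) :
  regularly_varying kappa gamma ->
  (forall T : R, 1 <= T ->
    lebesgue_L1 `[1, T] (fun t => gamma t / t `^ (kappa + 1))) ->
  slow_primitive (fun t => gamma t / t `^ kappa)
    (fun t => lebesgue_int 1 t (fun s => gamma s / s `^ (kappa + 1))).
Proof.
move=> rv L1; have [g0 _ _] := rv.
have wE (s : R) : 1 <= s -> s * (gamma s / s `^ (kappa + 1)) = gamma s / s `^ kappa.
  move=> s1; have s0 : 0 < s by lra.
  have sk := powR_gt0 kappa s0.
  rewrite powRD; last by rewrite (gt_eqF s0) implybT.
  by rewrite powRr1 ?ltW//; field; rewrite !gt_eqF.
split.
- by move=> t t1; rewrite divr_gt0 ?powR_gt0 ?g0//; lra.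
- move=> L e e0; have H := regularly_varying_ratio rv L e0.
  near=> t => s /andP[ts sL].
  have t0 : 0 < t by near: t; apply: nbhs_pinfty_gt; exact: num_real.
  have Ht : forall l, 1 <= l <= L ->
      (1 - e) * (gamma t / t `^ kappa) <= gamma (l * t) / (l * t) `^ kappa
        <= (1 + e) * (gamma t / t `^ kappa) by near: t.
  have := Ht (s / t); rewrite divfK ?gt_eqF//; apply.
  by rewrite ler_pdivlMr// mul1r ts ler_pdivrMr.
- apply: Rintegral_ge0 => s; rewrite /= in_itv/= => /andP[s1 _].
  by rewrite divr_ge0 ?powR_ge0// ltW// g0//; lra.
- move=> c x y x1 xy cl.
  have [H _] := lebesgue_int_log_bounds c (L1 y (le_trans x1 xy)) x1 xy.
  apply: H => s /andP[xs sy]; rewrite wE; last exact: le_trans xs.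
  by apply: cl; rewrite xs.
- move=> c x y x1 xy cl.
  have [_ H] := lebesgue_int_log_bounds c (L1 y (le_trans x1 xy)) x1 xy.
  apply: H => s /andP[xs sy]; rewrite wE; last exact: le_trans xs.
  by apply: cl; rewrite xs.
Unshelve. all: by end_near. Qed.

Lemma lebesgue_int_bounded (R : realType) (w : R -> R) :
  (forall t : R, 0 < t -> 0 <= w t) -> lebesgue_L1 `]0, +oo[ w ->
  exists B, forall t, 1 <= t -> lebesgue_int 1 t w <= B.
Proof.
move=> w0 wL.
exists (\int[@completed_lebesgue_measure R]_(s in `]0%R, +oo[) w s)%R.
move=> t t1.
have sub : `[1, t] `<=` `]0, +oo[%classic.
  by move=> s /=; rewrite !in_itv/= andbT => /andP[s1 _]; lra.
have mt : measurable (`[1, t]%classic : set (lebesgueTypeR R)).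
  exact: lebesgueTypeR_itv.
have moo : measurable (`]0, +oo[%classic : set (lebesgueTypeR R)).
  exact: lebesgueTypeR_itv.
have wt := integrableS moo mt sub wL.
apply: fine_le.
- exact: integrable_fin_num wt.
- exact: integrable_fin_num wL.
- have := (@ge0_subset_integral _ _ _ (@completed_lebesgue_measure R)
    _ _ mt moo (fun s => (w s)%:E)); apply.
  + by case/integrableP : wL.
  + by move=> s /=; rewrite in_itv/= andbT => s0; rewrite lee_fin w0.
  + exact: sub.
Qed.

Lemma pantograph_exponent (R : realType) (q a b kappa : R) :
  0 < q -> q < 1 -> 0 < a -> b < 0 -> `|a| < `|b| ->
  kappa = - (ln `|b / a| / ln (1 / q)) -> kappa <= 0 /\ a * q `^ kappa = - b.
Proof.
move=> q0 q1 a0 b0 ab ->.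
have lq0 : 0 < ln (1 / q) by rewrite ln_gt0// ltr_pdivlMr// mul1r.
have ba : `|b / a| = - b / a by rewrite normrM normfV (gtr0_norm a0) (ltr0_norm b0).
have ba1 : 1 < - b / a.
  by move: ab; rewrite (gtr0_norm a0) (ltr0_norm b0) ltr_pdivlMr// mul1r.
split.
  by rewrite oppr_le0; apply: divr_ge0; [rewrite ba ln_ge0// ltW|exact: ltW].
rewrite /powR gt_eqF// ba.
have -> : - (ln (- b / a) / ln (1 / q)) * ln q = ln (- b / a).
  have lqE : ln q = - ln (1 / q) by rewrite div1r lnV ?opprK.
  by rewrite lqE; field; rewrite gt_eqF.
rewrite lnK ?posrE; last lra.
by rewrite mulrC divfK// gt_eqF.
Qed.

Theorem theorem3 (R : realType) (q a b kappa xi : R)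
    (hq0 : 0 < q) (hq1 : q < 1) (ha : 0 < a) (hb : b < 0)
    (hab : `|a| < `|b|)
    (hkappa : kappa = - (ln `|b / a| / ln (1 / q))) :
  (forall (C : R) (gamma : R -> R),
     0 < C -> regularly_varying kappa gamma ->
     (* the integrals over [1, T] in the conclusion are well defined *)
     (forall T : R, 1 <= T ->
        lebesgue_L1 `[1, T] (fun t : R => gamma t / t `^ (kappa + 1))) ->
     ~ lebesgue_L1 `]0, +oo[ (fun t : R => gamma t / t `^ (kappa + 1)) ->
     exists phi : R -> R,
       [/\ {within `[0, +oo[%classic, continuous phi},
           asymp_equiv phi (fun t : R => C * gamma t) &
           exists z : R -> R,
             unique_pantograph_solution q a b phi xi z /\
             exists D : R, 0 < D /\
               asymp_equiv z (fun t : R =>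
                 D * t `^ kappa *
                 lebesgue_int 1 t (fun s : R => gamma s / s `^ (kappa + 1)))])
  /\
  (forall (C : R) (gamma : R -> R),
     0 < C -> regularly_varying kappa gamma ->
     lebesgue_L1 `]0, +oo[ (fun t : R => gamma t / t `^ (kappa + 1)) ->
     exists phi : R -> R,
       [/\ {within `[0, +oo[%classic, continuous phi},
           asymp_equiv phi (fun t : R => C * gamma t) &
           exists z : R -> R,
             unique_pantograph_solution q a b phi xi z /\
             exists D : R, 0 < D /\ asymp_equiv z (fun t : R => D * t `^ kappa)]).
Proof.
have [k0 aq] := pantograph_exponent hq0 hq1 ha hb hab hkappa.
have ab : a + b < 0 by move: hab; rewrite (gtr0_norm ha) (ltr0_norm hb); lra.
have scale (f g : R -> R) (D : R) : 0 < D -> f t / g t @[t --> +oo] --> D ->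
    asymp_equiv f (fun t => D * g t).
  move=> D0 fg; rewrite /asymp_equiv -(mulVf (lt0r_neq0 D0)).
  under eq_fun do rewrite invfM mulrCA.
  by apply: cvgM => //; exact: cvg_cst.
have phiC (C : R) (gamma phi : R -> R) : 0 < C ->
    phi t / (t `^ kappa * (gamma t / t `^ kappa)) @[t --> +oo] --> C ->
    asymp_equiv phi (fun t => C * gamma t).
  move=> C0 H; apply: scale => //; apply: cvg_pinfty_eq H; near=> t.
  have t0 : 0 < t by near: t; apply: nbhs_pinfty_gt; exact: num_real.
  by rewrite [t `^ kappa * _]mulrC divfK// gt_eqF// powR_gt0.
split => C gamma C0 rv.
  move=> L1 _; have S := regularly_varying_slow_primitive rv L1.
  have [phi [z [cphi phiE zsol zunb zbd]]] :=
    pantograph_construction xi S hq0 hq1 ha hb ab k0 aq C0.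
  exists phi; split => //; first exact: phiC.
  exists z; split => //.
  set J := fun t : R => lebesgue_int 1 t _ in S zunb zbd.
  have [JA|JnA] := pselect (forall A, exists2 t, 1 <= t & A < J t).
    have [D D0 zD] := zunb JA; exists D; split => //.
    by under [X in asymp_equiv _ X]eq_fun do rewrite -mulrA; exact: scale.
  have [B JB] : exists B, forall t, 1 <= t -> J t <= B.
    apply: contrapT => nB; apply: JnA => A; apply: contrapT => nA.
    apply: nB; exists A => t t1; rewrite leNgt; apply/negP => At.
    by apply: nA; exists t.
  have [l [L [l0 L0 Jl zL]]] := zbd B JB.
  exists (L / l); split; first exact: divr_gt0.
  under [X in asymp_equiv _ X]eq_fun do rewrite -mulrA.
  apply: scale; first exact: divr_gt0.
  under eq_fun do rewrite invfM mulrA.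
  by apply: cvgM => //; apply: cvgV => //; rewrite gt_eqF.
move=> L1; have [g0 _ _] := rv.
have [B JB] : exists B, forall t, 1 <= t ->
    lebesgue_int 1 t (fun s => gamma s / s `^ (kappa + 1)) <= B.
  apply: lebesgue_int_bounded L1 => t t0.
  by rewrite divr_ge0 ?powR_ge0// ltW// g0// ltW.
have L1T (T : R) : 1 <= T ->
    lebesgue_L1 `[1, T] (fun t => gamma t / t `^ (kappa + 1)).
  move=> _; apply: integrableS L1; [exact: lebesgueTypeR_itv|exact: lebesgueTypeR_itv|].
  by move=> s /=; rewrite !in_itv/= andbT => /andP[s1 _]; lra.
have S := regularly_varying_slow_primitive rv L1T.
have [phi [z [cphi phiE zsol _ zbd]]] :=
  pantograph_construction xi S hq0 hq1 ha hb ab k0 aq C0.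
have [l [L [_ L0 _ zL]]] := zbd B JB.
exists phi; split => //; first exact: phiC.
by exists z; split => //; exists L; split => //; exact: scale.
Unshelve. all: by end_near. Qed.
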